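(* Let $f \in H^1$ with $\|f\|_{H^1} = 1$, and suppose that for some measurable set $A \subset \mathbb{T}$ we have $\int_A \operatorname{Re} f(e^{it}) \, \frac{dt}{2\pi} \ge 1 - \epsilon$, where $\epsilon < 1/4$. Then \[ m(A) \ge \max_{0<\gamma<1} \frac{\log(\gamma+\epsilon) - \log(1-2\epsilon)}{\log\gamma}. \]
   Context: $\mathbb{T}$ is the unit circle and $m$ is arc length measure on $\mathbb{T}$ divided by $2\pi$ (so $m(\mathbb{T})=1$). $H^1$ is the space of analytic functions $f$ on the open unit disc with $\|f\|_{H^1} = \sup_{0\le r<1} \frac{1}{2\pi}\int_0^{2\pi} |f(re^{i\theta})|\,d\theta < \infty$. On $\mathbb{T}$, $f$ denotes the boundary function given by radial limits (which exist almost everywhere); $\|f\|_{H^1}$ equals the $L^1$ norm of the boundary function with respect to $m$. *)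

(* Defs.v *)
From HB Require Import structures.
From mathcomp Require Import all_boot all_order all_algebra.
From mathcomp Require Import complex.
From mathcomp Require Import all_classical all_reals all_analysis.

Set Implicit Arguments.
Unset Strict Implicit.
Unset Printing Implicit Defensive.

Import Order.TTheory GRing.Theory Num.Theory.
Import numFieldNormedType.Exports.
Import ComplexField.Normc.

Local Open Scope classical_set_scope.
Local Open Scope ring_scope.
Local Open Scope complex_scope.

(* The topology of the complex plane is carried by the alias R[i]^o, hence the
   type casts below; normc is the R-valued modulus. *)

Definition unit_disc (R : realType) : set R[i] := [set z | normc z < 1].

Definition unit_circle (R : realType) : set R[i] := [set z | normc z = 1].

Definition expi (R : realType) (t : R) : R[i] := cos t +i* sin t.

(* Functions on a subset D are total functions R[i] -> R[i] of which only the
   values on D matter; D is meant to be open. *)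
Definition analytic_on (R : realType) (D : set R[i]) (f : R[i] -> R[i]) :=
  forall z0, D z0 -> exists a : nat -> R[i],
    \forall z \near (z0 : R[i]^o),
      series (fun n => (a n * (z - z0) ^+ n : R[i]^o)) @ \oo --> (f z : R[i]^o).

Definition H1norm (R : realType) (f : R[i] -> R[i]) : \bar R :=
  ereal_sup
    [set ((2 * pi)^-1%:E *
          \int[lebesgue_measure]_(t in `[0%R, (2 * pi)%R])
            (normc (f (r%:C * expi t)))%:E)%E
    | r in [set r : R | 0 <= r < 1]].

Definition H1 (R : realType) : set (R[i] -> R[i]) :=
  [set f | analytic_on (@unit_disc R) f /\ (H1norm f < +oo)%E].

(* Radial limit at w; an arbitrary default value where it does not exist. *)
Definition boundary (R : realType) (f : R[i] -> R[i]) (w : R[i]) : R[i] :=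
  lim ((f (r%:C * w) : R[i]^o) @[r --> (1 : R)^'-]).

Definition angles (R : realType) (A : set R[i]) : set R :=
  [set t | 0 <= t < 2 * pi /\ A (expi t)].

(* Lebesgue (not only Borel) measurable subsets of the circle: measurability is
   that of the Caratheodory sigma-algebra of the Lebesgue outer measure, on
   which completed_lebesgue_measure is defined. *)
Definition circle_measurable (R : realType) (A : set R[i]) :=
  A `<=` @unit_circle R /\
  measurable (angles A : set (caratheodory_type (wlength (@idfun R))^*%mu)).

Definition circle_measure (R : realType) (A : set R[i]) : \bar R :=
  ((2 * pi)^-1%:E * completed_lebesgue_measure (angles A))%E.

Definition measure_bound (R : realType) (eps gamma : R) : R :=
  (ln (gamma + eps) - ln (1 - 2 * eps)) / ln gamma.

(* Main.v *)
(* Let f_r(t) = f(r e^(it)) and let w be gamma on A and 1 off A.  For a suitable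
   r < 1 the integral of (Re f_r)^+ over A is at least 1 - e with e close to eps;
   this only uses Fatou's lemma.  Since the mean of |f_r| is at most 1, the mean
   value property gives Re f(0) >= 2 (1 - e) - 1 = 1 - 2 e, while subharmonicity
   of ln(|f|^2 + tau^2) and Jensen's inequality give
     ln |f(0)| + m(A) ln gamma <= mean of ln((|f_r| + tau) w)
                               <= ln(mean of (|f_r| + tau) w)
                               <= ln(gamma + e + tau).
   Let e tend to eps and tau to 0. *)
Require Import Defs.
From mathcomp Require Import all_boot all_order all_algebra.
From mathcomp Require Import complex ring lra.
From mathcomp Require Import all_classical all_reals all_analysis.
From mathcomp Require Import measurable_realfun.

Set Implicit Arguments.
Unset Strict Implicit.
Unset Printing Implicit Defensive.

Import Order.TTheory GRing.Theory Num.Theory.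
Import numFieldNormedType.Exports.
Import ComplexField.Normc.

Local Open Scope classical_set_scope.
Local Open Scope ring_scope.
Local Open Scope complex_scope.

Local Arguments normc : simpl never.

(** * Modulus and topology of the complex plane *)

(** Analyticity enters through second-order Taylor expansions with a cubic remainder. They give an
    inequality between the value of a function at a point and its values at four neighbours, and a
    maximum principle turns this inequality into one for circular means. Adding tau^2 under the
    logarithm keeps it continuous at the zeros of f. The term 1 - 2 e arises because -Re f_r <=
    |f_r| everywhere, while on A even -Re f_r <= |f_r| - 2 (Re f_r)^+. The term gamma + e arises
    because lowering the weight from 1 to gamma on A removes at least (1 - gamma)(1 - e) from a mean
    that is at most 1, and 1 - (1 - gamma)(1 - e) = gamma + (1 - gamma) e. The positive part of Re
    f_r is used because Fatou's lemma asks for nonnegative integrands. A circle of radius r < 1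
    reaches only values below the boundary integral, hence e > eps and a final limit. *)

Lemma normr_normc (R : rcfType) (z : R[i]) : `|z| = (normc z)%:C.
Proof. by rewrite normc_def; case: z. Qed.

Lemma normc_ge0 (R : rcfType) (z : R[i]) : 0 <= normc z.
Proof. by case: z => a b; rewrite sqrtr_ge0. Qed.

Lemma normc_sqrE (R : rcfType) (z : R[i]) :
  normc z ^+ 2 = complex.Re z ^+ 2 + complex.Im z ^+ 2.
Proof. by case: z => a b; rewrite sqr_sqrtr// addr_ge0// sqr_ge0. Qed.

Lemma normc_real (R : rcfType) (x : R) : normc x%:C = `|x|.
Proof. by rewrite /normc/= expr0n addr0 sqrtr_sqr. Qed.

Lemma normcX (R : rcfType) (z : R[i]) n : normc (z ^+ n) = normc z ^+ n.
Proof. by elim: n => [|n IH]; rewrite ?expr0 ?normc1// !exprS normcM IH. Qed.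

Lemma normcD_le (R : rcfType) (x y : R[i]) : normc (x + y) <= normc x + normc y.
Proof. by rewrite -lecR rmorphD/= -!normr_normc ler_normD. Qed.

Lemma normcB_le (R : rcfType) (x y : R[i]) : normc (x - y) <= normc x + normc y.
Proof. by rewrite -lecR rmorphD/= -!normr_normc ler_normB. Qed.

Lemma normcNE (R : rcfType) (x : R[i]) : normc (- x) = normc x.
Proof. by apply: complexI; rewrite -!normr_normc normrN. Qed.

Lemma normc_sum_le (R : rcfType) n (F : nat -> R[i]) :
  normc (\sum_(k < n) F k) <= \sum_(k < n) normc (F k).
Proof.
elim: n => [|n IH]; first by rewrite !big_ord0 normc0.
rewrite !big_ord_recr/=.
by apply: (le_trans (normcD_le _ _)); rewrite lerD2r.
Qed.

Lemma normc_eq0 (R : rcfType) (z : R[i]) : (normc z == 0) = (z == 0).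
Proof. by apply/eqP/eqP => [/eq0_normc//|->]; rewrite normc0. Qed.

Lemma normr_Re_le (R : rcfType) (z : R[i]) : `|complex.Re z| <= normc z.
Proof.
rewrite -[X in X <= _]ger0_norm// -[X in _ <= X]ger0_norm ?normc_ge0//.
rewrite -ler_sqr ?nnegrE//; rewrite !normr_id real_normK ?num_real//.
by rewrite ger0_norm ?normc_ge0// normc_sqrE lerDl sqr_ge0.
Qed.

Lemma normc_le_ReIm (R : rcfType) (z : R[i]) :
  normc z <= `|complex.Re z| + `|complex.Im z|.
Proof.
rewrite -ler_sqr ?nnegrE ?normc_ge0 ?addr_ge0// normc_sqrE sqrrD.
by rewrite !real_normK ?num_real// lerD2r lerDl mulrn_wge0// mulr_ge0.
Qed.

Lemma normci (R : rcfType) : normc ('i : R[i]) = 1.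
Proof. by rewrite /normc expr0n add0r expr1n sqrtr1. Qed.

Lemma nbhs_normc (R : realType) (z0 : R[i]) (P : set R[i]) :
  (\forall z \near (z0 : R[i]^o), P z) ->
  exists2 d : R, 0 < d & forall h, normc h < d -> P (z0 + h).
Proof.
move=> /(@nbhs_normP _ R[i]^o)[e /= e0 eP]; exists (complex.Re e).
  by move: e0; rewrite ltcE => /andP[].
move=> h hd; apply: eP => /=.
rewrite opprD addNKr normrN normr_normc.
by move: e0 hd; rewrite !ltcE/= => /andP[/eqP -> _] ->; rewrite eqxx.
Qed.

Lemma cvg_normcP (R : realType) (T : Type) (F : set_system T) (FF : Filter F)
    (g : T -> R[i]) (l : R[i]) :
  (g : T -> R[i]^o) @ F --> (l : R[i]^o) <->
  forall e, 0 < e -> \forall x \near F, normc (l - g x) < e.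
Proof.
split=> [/(@cvgrPdist_lt _ R[i]^o) gl e e0|gl].
  have := gl e%:C; rewrite ltcR => /(_ e0); apply: filterS => x.
  by rewrite normr_normc ltcR.
apply/(@cvgrPdist_lt _ R[i]^o) => e; rewrite ltcE => /andP[/eqP ime ree].
have := gl _ ree; apply: filterS => x gx.
by rewrite normr_normc ltcE/= ime gx eqxx.
Qed.

(** The remainder is an exact multiple [r * h ^+ 3] with bounded [r], rather than a norm estimate,
    so that combinations of expansions are settled by [ring]. Order two is what the four-point
    inequality sees; cubic terms are absorbed by its slack. *)
Definition taylor2 (R : realType) (f : R[i] -> R[i]) (z0 : R[i]) :=
  exists a1 a2 (rho C : R), 0 < rho /\
    forall h, normc h < rho -> exists2 r, normc r <= C &
      f (z0 + h) = f z0 + a1 * h + a2 * h ^+ 2 + r * h ^+ 3.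

Lemma analytic_taylor2 (R : realType) D (f : R[i] -> R[i]) z0 :
  analytic_on D f -> D z0 -> taylor2 f z0.
Proof.
move=> fa /fa[a] /nbhs_normc[d d0 fd].
have [rho rho0 rhoE] : exists2 rho, 0 < rho & rho = d / 2.
  by exists (d / 2) => //; rewrite divr_gt0.
(* The series converges at z0 + rho. From index N on, consecutive partial sums are both within 1 of
   the limit, so each term is at most 2; the finitely many earlier terms are simply added to the
   bound. *)
have [B B0 aB] : exists2 B, 0 <= B & forall n, normc (a n) * rho ^+ n <= B.
  have := fd rho%:C; rewrite normc_real gtr0_norm// addrC addKr.
  have -> : rho < d by rewrite rhoE; lra.
  move=> /(_ isT)/cvg_normcP/(_ _ ltr01)[N _ HN].
  exists (2 + \sum_(n < N) normc (a n) * rho ^+ n).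
    by rewrite addr_ge0// sumr_ge0// => n _; rewrite mulr_ge0 ?normc_ge0 ?exprn_ge0 ?(ltW rho0).
  move=> n; have [nN|Nn] := ltnP n N.
    rewrite (bigD1 (Ordinal nN))//= addrCA lerDl addr_ge0// sumr_ge0// => k _.
    by rewrite mulr_ge0 ?normc_ge0 ?exprn_ge0 ?(ltW rho0).
  apply: (@le_trans _ _ 2); last first.
    by rewrite lerDl sumr_ge0// => k _; rewrite mulr_ge0 ?normc_ge0 ?exprn_ge0 ?(ltW rho0).
  have h1 := HN _ Nn; have h2 := HN n.+1 (leqW Nn).
  have -> : normc (a n) * rho ^+ n = normc (a n * rho%:C ^+ n).
    by rewrite normcM normcX normc_real gtr0_norm.
  move: h1 h2 => /=; rewrite /series/= big_nat_recr//=.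
  set S := \sum_(_ <= _ < _) _; set t := _ * _ => h1 h2.
  have -> : t = (f (z0 + rho%:C) - S) - (f (z0 + rho%:C) - (S + t)) by ring.
  by apply: (le_trans (normcB_le _ _)); lra.
(* For |h| < rho / 2 the terms from index 3 on are dominated by B |h|^3 / rho^3 times a geometric
   series of ratio 1/2, whose sum is at most 2. *)
pose K := 2 * B / rho ^+ 3.
have K0 : 0 <= K by rewrite divr_ge0 ?mulr_ge0 ?exprn_ge0 ?(ltW rho0).
have key h : normc h < rho / 2 ->
    normc (f (z0 + h) - (a 0%N + a 1%N * h + a 2%N * h ^+ 2)) <= K * normc h ^+ 3.
  move=> hr; apply/ler_addgt0Pr => e e0.
  have := fd h; rewrite [z0 + h]addrC addrK [h + z0]addrC.
  have -> : normc h < d by lra.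
  move=> /(_ isT)/cvg_normcP/(_ _ e0)[N _ /(_ (3 + N)%N)].
  rewrite /= leq_addl => /(_ isT) /ltW fS.
  set T := f _ in fS *; set Q := a 0%N + _ + _.
  have -> : T - Q = (series (fun n => a n * h ^+ n) (3 + N)%N - Q) +
      (T - series (fun n => a n * h ^+ n) (3 + N)%N) by ring.
  apply: (le_trans (normcD_le _ _)); apply: lerD => //.
  rewrite /series/= big_mkord big_split_ord/= 3!big_ord_recl big_ord0/=.
  rewrite /bump/= !add1n !expr0 expr1 mulr1 addr0 addrA -/Q (addrC Q) addrK.
  apply: (le_trans (@normc_sum_le _ N (fun k => a (3 + k)%N * h ^+ (3 + k)))).
  have hb k : normc (a (3 + k)%N * h ^+ (3 + k)) <=
      B / rho ^+ 3 * normc h ^+ 3 * 2^-1 ^+ k.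
    rewrite normcM normcX.
    have -> : normc h ^+ (3 + k) =
        rho ^+ (3 + k) * ((normc h / rho) ^+ 3 * (normc h / rho) ^+ k).
      by rewrite -exprD -exprMn mulrC divfK// gt_eqF.
    rewrite mulrA; have -> : B / rho ^+ 3 * normc h ^+ 3 * 2^-1 ^+ k =
        B * ((normc h / rho) ^+ 3 * 2^-1 ^+ k).
      by rewrite exprMn (exprVn rho); ring.
    have hr0 : 0 <= normc h / rho by rewrite divr_ge0 ?normc_ge0 ?ltW.
    apply: ler_pM => //.
    - by rewrite mulr_ge0 ?normc_ge0 ?exprn_ge0 ?(ltW rho0).
    - by rewrite mulr_ge0 ?exprn_ge0.
    - rewrite ler_wpM2l ?exprn_ge0//; apply: lerXn2r; rewrite ?nnegrE ?invr_ge0//.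
      by rewrite ler_pdivrMr//; lra.
  apply: (le_trans (ler_sum _ (fun (k : 'I_N) _ => hb k))).
  rewrite -mulr_sumr /K.
  have : \sum_(k < N) 2^-1 ^+ k <= 2 :> R.
    have -> : \sum_(k < N) 2^-1 ^+ k = 2 - 2 * 2^-1 ^+ N :> R.
      elim: (N) => [|n IH]; first by rewrite big_ord0 expr0; lra.
      by rewrite big_ord_recr/= IH exprS; lra.
    by rewrite lerBlDr lerDl mulr_ge0// exprn_ge0// invr_ge0.
  set s := \sum_(_ < _) _ => s2.
  have -> : 2 * B / rho ^+ 3 * normc h ^+ 3 = B / rho ^+ 3 * normc h ^+ 3 * 2 by ring.
  by rewrite ler_wpM2l// mulr_ge0 ?divr_ge0 ?exprn_ge0 ?normc_ge0 ?(ltW rho0).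
have fz0 : f z0 = a 0%N.
  have := key 0; rewrite normc0 expr0n/= mulr0 addr0 expr0n/= !mulr0 !addr0.
  rewrite divr_gt0// => /(_ isT) /=.
  by rewrite le_eqVlt ltNge normc_ge0 orbF normc_eq0 subr_eq0 => /eqP.
exists (a 1%N), (a 2%N), (rho / 2), K; split; first by rewrite divr_gt0.
move=> h hr; rewrite fz0; have [->|h0] := eqVneq h 0.
  by exists 0; rewrite ?normc0// addr0 fz0 !expr0n/= !mulr0 !addr0.
exists ((f (z0 + h) - (a 0%N + a 1%N * h + a 2%N * h ^+ 2)) / h ^+ 3); last first.
  by rewrite divfK ?expf_neq0//; ring.
have nh0 : 0 < normc h by rewrite lt_neqAle normc_ge0 eq_sym normc_eq0 h0.
by rewrite normcM normcV normcX ler_pdivrMr ?exprn_gt0// key.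
Qed.

Lemma near_normc (R : realType) (z : R[i]) (e : R) : 0 < e ->
  \forall x \near (z : R[i]^o), normc (z - x) < e.
Proof.
move=> e0; apply/(@nbhs_normP _ R[i]^o); exists e%:C => [|x] /=; first by rewrite ltcR.
by rewrite normr_normc ltcR.
Qed.

Lemma cvg_complex (R : realType) (T : Type) (F : set_system T) (FF : Filter F)
    (x y : T -> R) (a b : R) :
  x @ F --> a -> y @ F --> b ->
  ((fun t => (x t +i* y t)%C) : T -> R[i]^o) @ F --> ((a +i* b)%C : R[i]^o).
Proof.
move=> /cvgrPdist_lt xa /cvgrPdist_lt yb; apply/cvg_normcP => e e0.
have e2 : 0 < e / 2 by rewrite divr_gt0.
near=> t; apply: (le_lt_trans (normc_le_ReIm _)) => /=.
rewrite [ltRHS]splitr; apply: ltrD; near: t; [exact: xa|exact: yb].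
Unshelve. all: by end_near. Qed.

Lemma continuous_normc (R : realType) : continuous (@normc R : R[i]^o -> R).
Proof.
move=> z; rewrite /continuous_at; apply/(@cvgrPdist_lt _ R^o _ (nbhs z)) => e e0.
near=> x; apply: (@le_lt_trans _ _ (normc (z - x))); last first.
  by near: x; exact: near_normc.
rewrite ler_norml; apply/andP; split.
  rewrite lerNl opprB lerBlDr -{1}(subrK z x) -[normc (z - x)]normcNE opprB.
  exact: normcD_le.
by rewrite lerBlDr -{1}(subrK x z) normcD_le.
Unshelve. all: by end_near. Qed.

Lemma continuous_Re (R : realType) : continuous (@complex.Re R : R[i]^o -> R).
Proof.
move=> z; rewrite /continuous_at; apply/(@cvgrPdist_lt _ R^o _ (nbhs z)) => e e0.
near=> x; apply: (@le_lt_trans _ _ (normc (z - x))); last first.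
  by near: x; exact: near_normc.
by have := normr_Re_le (z - x); case: (z) (x) => a b [c d].
Unshelve. all: by end_near. Qed.

Lemma taylor2_continuous (R : realType) (f : R[i] -> R[i]) z0 : taylor2 f z0 ->
  f x @[x --> (z0 : R[i]^o)] --> (f z0 : R[i]^o).
Proof.
move=> [a1 [a2 [rho [C [rho0 H]]]]].
apply/(@cvg_normcP _ R[i]^o (nbhs (z0 : R[i]^o))) => e e0.
pose K := normc a1 + normc a2 + `|C| + 1.
have K0 : 0 < K by rewrite ltr_wpDl// !addr_ge0 ?normc_ge0.
pose d := Num.min rho (Num.min 1 (e / K)).
have d0 : 0 < d by rewrite !lt_min rho0 ltr01 divr_gt0.
near=> x; have : normc (z0 - x) < d by near: x; exact: near_normc.
rewrite /d !lt_min => /and3P[].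
rewrite -normcNE opprB; set h := x - z0.
have -> : x = z0 + h by rewrite addrC subrK.
move=> hr h1 hK; have [r rC ->] := H _ hr.
have -> : f z0 - (f z0 + a1 * h + a2 * h ^+ 2 + r * h ^+ 3) =
   - ((a1 + a2 * h + r * h ^+ 2) * h) by ring.
rewrite normcNE normcM.
apply: (@le_lt_trans _ _ (K * normc h)); last by rewrite mulrC -ltr_pdivlMr.
rewrite ler_wpM2r ?normc_ge0//.
apply: (le_trans (normcD_le _ _)).
have hh := normc_ge0 h.
have : normc (a1 + a2 * h) <= normc a1 + normc a2.
  apply: (le_trans (normcD_le _ _)); rewrite lerD2l normcM ler_piMr ?normc_ge0//.
  exact: ltW.
have : normc (r * h ^+ 2) <= `|C|.
  rewrite normcM normcX; apply: (@le_trans _ _ (normc r)).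
    by rewrite ler_piMr ?normc_ge0// exprn_ile1// ltW.
  by rewrite (le_trans rC)// ler_norm.
rewrite /K; lra.
Unshelve. all: by end_near. Qed.

(** * Polar coordinates *)

Lemma expiD (R : realType) (s t : R) : expi (s + t) = expi s * expi t.
Proof.
by apply/eqP; rewrite eq_complex/= cosD sinD; apply/andP; split; apply/eqP; ring.
Qed.

Lemma normc_expi (R : realType) (t : R) : normc (expi t) = 1.
Proof.
by apply/eqP; rewrite -(@eqrXn2 _ 2)// ?normc_ge0// normc_sqrE/= cos2Dsin2 expr1n.
Qed.

Lemma expi2pi (R : realType) : expi (2 * pi) = 1 :> R[i].
Proof. by rewrite /expi mulr_natl cos2pi sin2pi. Qed.

Lemma expi0 (R : realType) : expi 0 = 1 :> R[i].
Proof. by rewrite /expi cos0 sin0. Qed.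

Lemma polarP (R : realType) (z : R[i]) :
  exists2 t : R, 0 <= t <= 2 * pi & z = (normc z)%:C * expi t.
Proof.
have [->|z0] := eqVneq z 0.
  by exists 0; rewrite ?lexx ?mulr_ge0 ?pi_ge0// normc0 rmorph0 mul0r.
have n0 : normc z != 0 by rewrite normc_eq0.
pose x := complex.Re z / normc z; pose y := complex.Im z / normc z.
have zE : z = (normc z)%:C * (x +i* y).
  apply/eqP; rewrite eq_complex/= !mul0r subr0 addr0.
  by rewrite /x /y ![normc z * _]mulrC !divfK// !eqxx.
have xy : x ^+ 2 + y ^+ 2 = 1.
  by rewrite !expr_div_n -mulrDl -normc_sqrE divff// expf_neq0.
have x1 : -1 <= x <= 1.
  rewrite -ler_norml -(@ler_pXn2r _ 2)// ?nnegrE// expr1n.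
  by rewrite real_normK ?num_real// -xy lerDl sqr_ge0.
have p0 := pi_ge0 R.
have := acos_ge0 x1; have := acos_lepi x1.
have cx : cos (acos x) = x by rewrite acosK// in_itv.
have sx : sin (acos x) = `|y|.
  by rewrite sin_acos// -xy addrC addKr sqrtr_sqr.
move=> ax1 ax0; have [y0|y0] := leP 0 y.
  exists (acos x); first by rewrite ax0; lra.
  by rewrite /expi cx sx ger0_norm.
exists (2 * pi - acos x); first by apply/andP; split; lra.
rewrite expiD expi2pi mul1r /expi cosN sinN cx sx ltr0_norm// opprK.
exact: zE.
Qed.

Lemma continuous_expi (R : realType) : continuous (@expi R : R -> R[i]^o).
Proof.
move=> t; apply: cvg_complex; [exact: continuous_cos|exact: continuous_sin].
Qed.

Lemma continuous_polar (R : realType) :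
  continuous (fun p : R * R => p.1%:C * expi p.2 : R[i]^o).
Proof.
move=> [s t]; rewrite /continuous_at/=.
have -> : (fun p : R * R => p.1%:C * expi p.2) =
    (fun p => (p.1 * cos p.2) +i* (p.1 * sin p.2)).
  by apply/funext => p; apply/eqP; rewrite eq_complex/= !mul0r subr0 addr0 !eqxx.
have -> : s%:C * expi t = (s * cos t) +i* (s * sin t).
  by apply/eqP; rewrite eq_complex/= !mul0r subr0 addr0 !eqxx.
apply: cvg_complex; apply: cvgM.
- exact: cvg_fst.
- by apply: (@cvg_comp _ _ _ snd (@cos R) _ (nbhs t)); [exact: cvg_snd|exact: continuous_cos].
- exact: cvg_fst.
- by apply: (@cvg_comp _ _ _ snd (@sin R) _ (nbhs t)); [exact: cvg_snd|exact: continuous_sin].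
Qed.

Definition ccontinuous_at (R : realType) (u : R[i] -> R) (z : R[i]) :=
  u x @[x --> (z : R[i]^o)] --> u z.

(** * Submean functions *)

(* A pointwise form of subharmonicity: the sum runs over the four points
   z0 + i^k h, and the slack eta |h|^2 makes the condition checkable on
   second-order expansions and stable under sums and rotations. *)
Definition submean (R : realType) (u : R[i] -> R) (z0 : R[i]) :=
  forall eta, 0 < eta -> exists2 d, 0 < d & forall h, normc h < d ->
    4 * u z0 <= u (z0 + h) + u (z0 - h) + u (z0 + 'i%C * h) + u (z0 - 'i%C * h)
                + eta * normc h ^+ 2.

(* Adding eta |z|^2 makes u strictly submean, so that its maximum over the closed
   disc of radius r is attained on the boundary. *)
Lemma submean_max (R : realType) (u : R[i] -> R) (r eta : R) :
  0 < r < 1 -> 0 < eta ->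
  (forall z, normc z < 1 -> ccontinuous_at u z) ->
  (forall z, normc z < 1 -> submean u z) ->
  exists2 t, 0 <= t <= 2 * pi & u 0 <= u (r%:C * expi t) + eta.
Proof.
move=> /andP[r0 r1] eta0 uc us.
pose v (z : R[i]) := u z + eta * normc z ^+ 2.
(* The closed disc is the image of this rectangle under polar coordinates, so compactness comes from
   a product of two segments. *)
pose K : set (R * R) := `[0, r] `*` `[0, 2 * pi].
have KP s t : 0 <= s <= r -> 0 <= t <= 2 * pi -> (s, t) \in K.
  by move=> sr tp; rewrite inE; split; rewrite /= in_itv.
have p2 : 0 <= 2 * pi :> R by rewrite mulr_ge0 ?pi_ge0.
have nrm s t : 0 <= s -> normc (s%:C * expi t) = s :> R.
  by move=> s0; rewrite normcM normc_expi mulr1 normc_real ger0_norm.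
have [] := @compact_EVT_max _ _ (fun p : R * R => v (p.1%:C * expi p.2)) K.
- by exists (0, 0); rewrite -inE; apply: KP; rewrite lexx ?(ltW r0).
- by apply: compact_setX; exact: segment_compact.
- apply: (@continuous_in_subspaceT _ _ K) => -[s t]; rewrite inE => -[/=].
  rewrite !in_itv/= => /andP[s0 sr] _.
  have vc : ccontinuous_at v (s%:C * expi t).
    apply: (@cvgD _ _ _ (nbhs (s%:C * expi t : R[i]^o))).
      by apply: (uc _ _); rewrite nrm//; lra.
    apply: (@cvgM _ _ (nbhs (s%:C * expi t : R[i]^o))); first exact: cvg_cst.
    by apply: (@cvgM _ _ (nbhs (s%:C * expi t : R[i]^o))); exact: continuous_normc.
  exact: (cvg_comp _ _ (@continuous_polar R (s, t)) vc).
move=> [s t] /[!inE]/= -[/=]; rewrite !in_itv/= => /andP[s0 sr] tp vmax.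
have {}vmax z : normc z <= r -> v z <= v (s%:C * expi t).
  move=> zr; have [t' t'p zE] := polarP z.
  by have := vmax (normc z, t'); rewrite -zE; apply; apply: KP => //; rewrite normc_ge0.
have [sr'|] := ltP s r; last first.
  move=> rs; exists t => //.
  have -> : r = s by apply/eqP; rewrite eq_le rs sr.
  have := vmax 0; rewrite normc0 (ltW r0) => /(_ isT).
  rewrite /v normc0 expr0n/= mulr0 addr0 => /le_trans; apply.
  rewrite lerD2l nrm// ler_piMr ?(ltW eta0)//; rewrite exprn_ile1//; lra.
exfalso; set z0 := s%:C * expi t in vmax.
have nz0 : normc z0 = s by exact: nrm.
have z01 : normc z0 < 1 by rewrite nz0; lra.
have [d d0 ud] := us _ z01 _ eta0.
pose h := Num.min (d / 2) (r - s).
have h0 : 0 < h by rewrite lt_min divr_gt0// subr_gt0.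
have hd : h < d by rewrite gt_min; apply/orP; left; lra.
have hrs : h <= r - s by rewrite ge_min lexx orbT.
have nh : normc h%:C = h by rewrite normc_real gtr0_norm.
have nih : normc ('i%C * h%:C) = h by rewrite normcM normci mul1r.
have := ud h%:C; rewrite nh => /(_ hd) uh.
have v1 w : normc w = h -> v (z0 + w) <= v z0.
  move=> wh; apply: vmax; rewrite (le_trans (normcD_le _ _))// wh nz0; lra.
have := v1 _ nh; have := v1 (- h%:C); rewrite normcNE => /(_ nh).
have := v1 _ nih; have := v1 (- ('i%C * h%:C)); rewrite normcNE => /(_ nih).
(* The squares raise the four-point sum of v by 4 eta h^2, whereas the slack for u costs only eta
   h^2. The sum thus exceeds 4 v(z0), against the maximality of v at the interior point z0. *)
have nE : normc (z0 + h%:C) ^+ 2 + normc (z0 - h%:C) ^+ 2 +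
    normc (z0 + 'i%C * h%:C) ^+ 2 + normc (z0 - 'i%C * h%:C) ^+ 2 =
    4 * normc z0 ^+ 2 + 4 * h ^+ 2.
  by rewrite !normc_sqrE; case: (z0) => a b /=; ring.
rewrite /v => k1 k2 k3 k4; have := mulr_gt0 eta0 (exprn_gt0 2 h0).
move: nE => /(congr1 ( *%R eta)).
rewrite !mulrDr => e1 e2; nra.
Qed.

Lemma submeanD (R : realType) (u v : R[i] -> R) z0 :
  submean u z0 -> submean v z0 -> submean (fun z => u z + v z) z0.
Proof.
move=> us vs eta eta0; have eta2 : 0 < eta / 2 by rewrite divr_gt0.
have [d1 d10 H1] := us _ eta2; have [d2 d20 H2] := vs _ eta2.
exists (Num.min d1 d2); first by rewrite lt_min d10.
move=> h; rewrite lt_min => /andP[/H1 h1 /H2 h2]; lra.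
Qed.

Lemma submean_sum (R : realType) n (u : nat -> R[i] -> R) z0 :
  (forall k, submean (u k) z0) -> submean (fun z => \sum_(k < n) u k z) z0.
Proof.
move=> us; elim: n => [|n IH].
  move=> eta eta0; exists 1 => // h _; rewrite !big_ord0 !addr0 mulr0 add0r.
  by rewrite mulr_ge0 ?exprn_ge0 ?normc_ge0// ltW.
have := submeanD IH (us n); rewrite /submean => H eta eta0.
have [d d0 Hd] := H _ eta0; exists d => // h /Hd.
by rewrite !big_ord_recr.
Qed.

Lemma submean_rot (R : realType) (u : R[i] -> R) w z0 : normc w = 1 ->
  submean u (w * z0) -> submean (fun z => u (w * z)) z0.
Proof.
move=> w1 us eta eta0; have [d d0 H] := us _ eta0.
exists d => // h hd; have := H (w * h); rewrite normcM w1 mul1r => /(_ hd).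
by rewrite !mulrDr !mulrN (mulrCA w).
Qed.

Lemma continuous_rot (R : realType) (u : R[i] -> R) (w z : R[i]) :
  ccontinuous_at u (w * z) ->
  ccontinuous_at (fun z => u (w * z)) z.
Proof.
move=> uc; apply: (@cvg_comp _ _ _ ( *%R w) u (nbhs (z : R[i]^o)) (nbhs (w * z : R[i]^o))) => //.
exact: (@mulrl_continuous R[i] w z).
Qed.

Lemma continuous_sum_for (R : realType) n (u : nat -> R[i] -> R) (z : R[i]) :
  (forall k, ccontinuous_at (u k) z) ->
  ccontinuous_at (fun z => \sum_(k < n) u k z) z.
Proof.
move=> uc; rewrite /ccontinuous_at; elim: n => [|n IH].
  under eq_fun do rewrite big_ord0; rewrite big_ord0.
  exact: (@cvg_cst _ _ _ (nbhs (z : R[i]^o))).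
under eq_fun do rewrite big_ord_recr/=; rewrite big_ord_recr/=.
apply: (@cvgD _ _ _ (nbhs (z : R[i]^o))); [exact: IH|exact: uc].
Qed.

(** * Riemann sums and circular means *)

Lemma segment_uniform_continuity (R : realType) (phi : R -> R) (a b e : R) :
  continuous phi -> 0 < e -> exists2 d, 0 < d &
    forall x y, x \in `[a, b] -> `|y - x| < d -> `|phi y - phi x| < e.
Proof.
move=> phic e0; have e2 : 0 < e / 2 by rewrite divr_gt0.
have /compact_near_coveringP := @segment_compact R a b.
move=> /(_ R (0^'+)  (fun d x => forall y, `|y - x| < d -> `|phi y - phi x| < e)).
case.
- move=> x _.
  have /cvgrPdist_lt/(_ _ e2)/nbhs_normP[d /= d0 Hd] := phic x.
  exists (ball x (d / 2), [set d' | d' < d / 2]).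
    split => /=; first by apply: nbhsx_ballx; rewrite divr_gt0.
    by apply: nbhs_right_lt; rewrite divr_gt0.
  move=> [x' d'] /= [xx' dd'] y yx'.
  have h1 : `|phi x - phi x'| < e / 2.
    by apply: Hd => /=; rewrite (lt_trans xx')//; lra.
  have h2 : `|phi x - phi y| < e / 2.
    apply: Hd => /=; move: xx' yx' dd'; rewrite /ball/= => *.
    rewrite -(subrKA x') (le_lt_trans (ler_normD _ _))// [`|x' - y|]distrC; lra.
  rewrite -(subrKA (phi x)) (le_lt_trans (ler_normD _ _))// [`|phi y - _|]distrC; lra.
- move=> d /= d0 Hd; exists (d / 2); first by rewrite divr_gt0.
  move=> x y xab; apply: Hd => //=; rewrite ?divr_gt0//.
  by rewrite /ball/= sub0r normrN gtr0_norm ?divr_gt0//; lra.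
Qed.

Lemma continuous_itv_integrable (R : realType) (phi : R -> R) (a b : R) :
  continuous phi -> (@lebesgue_measure R).-integrable `[a, b] (EFin \o phi).
Proof.
move=> phic; apply: continuous_compact_integrable; first exact: segment_compact.
exact: continuous_subspaceT.
Qed.

Lemma continuous_itv_oc_integrable (R : realType) (phi : R -> R) (a b : R) :
  continuous phi -> (@lebesgue_measure R).-integrable `]a, b] (EFin \o phi).
Proof.
move=> phic.
apply: (integrableS _ _ _ (@continuous_itv_integrable _ phi a b phic)) => //.
by apply: subset_itvr; rewrite bnd_simp.
Qed.

(** Every point of the k-th cell is within c of its tag, so phi exceeds the tag's value minus e
    there. All tags share the offset t because they will be the arguments of one point rotated by
    the N-th roots of unity. *)
Lemma riemann_sum_le (R : realType) (phi : R -> R) (c e t : R) n :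
  continuous phi -> 0 < c -> 0 <= t <= c ->
  (forall x y, x \in `[0, n%:R * c] -> `|y - x| <= c -> `|phi y - phi x| < e) ->
  \sum_(k < n) (phi (t + k%:R * c) - e) * c <=
  \int[lebesgue_measure]_(x in `[0, n%:R * c]) phi x.
Proof.
move=> phic c0 tc H; elim: n H => [|n IH] H.
  by rewrite big_ord0 mul0r set_itv1 Rintegral_set1.
have nc : n%:R * c <= n.+1%:R * c by rewrite ler_wpM2r ?ler_nat// ltW.
rewrite big_ord_recr/=.
have -> : \int[lebesgue_measure]_(x in `[0, n.+1%:R * c]) phi x =
  \int[lebesgue_measure]_(x in `[0, n%:R * c]) phi x +
  \int[lebesgue_measure]_(x in `]n%:R * c, n.+1%:R * c]) phi x.
  rewrite -(@Rintegral_itvB _ _ (BLeft 0) (BRight (n.+1%:R * c)) (n%:R * c)).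
  - by rewrite addrC subrK.
  - exact: continuous_itv_integrable.
  - by rewrite bnd_simp mulr_ge0 ?ler0n// ltW.
  - by rewrite bnd_simp.
apply: lerD.
  apply: IH => x y xn; apply: H; move: xn; rewrite !in_itv/= => /andP[-> xn].
  exact: le_trans nc.
have mI : @lebesgue_measure R `]n%:R * c, n.+1%:R * c] = c%:E.
  rewrite lebesgue_measure_itv/= lte_fin ifT; last by rewrite ltr_pM2r// ltr_nat.
  by rewrite -EFinB -mulrBl -natrB// subSnn mul1r.
have -> : (phi (t + n%:R * c) - e) * c =
    \int[lebesgue_measure]_(x in `]n%:R * c, n.+1%:R * c]) (phi (t + n%:R * c) - e).
  by rewrite Rintegral_cst//; congr (_ * _); exact: esym (congr1 fine mI).
apply: le_Rintegral => //.
- apply: (@continuous_itv_oc_integrable _ (fun=> _)) => x; exact: cvg_cst.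
- exact: continuous_itv_oc_integrable.
move=> x; rewrite /= in_itv/= => /andP[nx xn].
have := H x (t + n%:R * c).
rewrite in_itv/= xn (le_trans _ (ltW nx)) ?mulr_ge0 ?ler0n// ?(ltW c0)// => /(_ isT).
move: nx xn tc; rewrite -natr1 mulrDl mul1r => nx xn /andP[t0 tc].
have -> : `|t + n%:R * c - x| <= c by rewrite ler_norml; apply/andP; split; lra.
by move=> /(_ isT); rewrite ltr_norml => /andP[_]; lra.
Qed.

(* The maximum principle is applied to the average of the rotations of u by the
   N-th roots of unity: on the circle of radius r this average is a Riemann sum
   for the circular mean of u, uniformly close to it for N large. *)
Theorem submean_circle (R : realType) (u : R[i] -> R) (r : R) :
  0 < r < 1 ->
  (forall z, normc z < 1 -> ccontinuous_at u z) ->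
  (forall z, normc z < 1 -> submean u z) ->
  2 * pi * u 0 <= \int[lebesgue_measure]_(t in `[0, 2 * pi]) u (r%:C * expi t).
Proof.
move=> r01 uc us; have /andP[r0 r1] := r01.
pose phi t := u (r%:C * expi t).
have phic : continuous phi.
  move=> t.
  apply: (@cvg_comp _ _ _ (fun t => r%:C * expi t) u (nbhs t) (nbhs (r%:C * expi t : R[i]^o))).
    apply: (@cvg_comp _ _ _ (@expi R) ( *%R r%:C) (nbhs t) (nbhs (expi t : R[i]^o))).
      exact: continuous_expi.
    exact: (@mulrl_continuous R[i] r%:C (expi t)).
  by apply: uc; rewrite normcM normc_expi mulr1 normc_real gtr0_norm.
have p0 : 0 < 2 * pi :> R by rewrite mulr_gt0 ?pi_gt0.
apply/ler_addgt0Pr => e0 e00.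
(* The error is spent twice, each time up to 2 pi e: once on the Riemann sum and once on the slack
   of the maximum principle. *)
pose e := e0 / (4 * pi); have e1 : 0 < e by rewrite divr_gt0// mulr_gt0 ?pi_gt0.
have [d d0 Hd] := segment_uniform_continuity 0 (2 * pi) phic e1.
have [n nd] : exists n : nat, 2 * pi / n.+1%:R < d.
  exists (Num.truncn (2 * pi / d)); rewrite ltr_pdivrMr ?ltr0n// (mulrC d) -ltr_pdivrMr//.
  exact: truncnS_gt.
pose N := n.+1; pose c : R := 2 * pi / N%:R.
have c0 : 0 < c by rewrite divr_gt0 ?ltr0n.
have cN : N%:R * c = 2 * pi by rewrite /c mulrC divfK ?pnatr_eq0.
pose U z := \sum_(k < N) u (expi (k%:R * c) * z).
have nU k z : normc z < 1 -> normc (expi (k%:R * c) * z) < 1.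
  by rewrite normcM normc_expi mul1r.
have [t tp Ut] : exists2 t, 0 <= t <= 2 * pi & U 0 <= U (r%:C * expi t) + e.
  apply: submean_max => // z z1.
    by apply: (@continuous_sum_for _ N (fun k z => u (expi (k%:R * c) * z))) => k;
       apply: continuous_rot; apply: uc; exact: nU.
  by apply: (@submean_sum _ N (fun k z => u (expi (k%:R * c) * z))) => k;
     apply: submean_rot; [exact: normc_expi|apply: us; exact: nU].
(* Rotation by c shifts the summation index by one; the term leaving at the end is rotated by N c =
   2 pi and re-enters as the term of index 0. *)
have Uc z : U (expi c * z) = U z.
  rewrite /U [LHS]big_ord_recr [RHS]big_ord_recl/= addrC mul0r expi0 mul1r.
  rewrite mulrA -expiD -{2}(mul1r c) -mulrDl natr1.
  rewrite cN expi2pi mul1r; congr (_ + _); apply: eq_bigr => k _ /=.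
  by rewrite mulrA -expiD -{2}(mul1r c) -mulrDl natr1.
have Uj j z : U (expi (j%:R * c) * z) = U z.
  elim: j z => [|j IH] z; first by rewrite mul0r expi0 mul1r.
  by rewrite -natr1 mulrDl mul1r addrC expiD -mulrA Uc IH.
(* The point given by the maximum principle is rotated back into the first cell, where its angle can
   serve as the common offset of the tags. If t = 2 pi then j = N, which is harmless since U is
   invariant under every multiple of c. *)
pose j := Num.truncn (t / c).
have /andP[jt tj] : j%:R <= t / c < j.+1%:R.
  by apply: truncn_itv; rewrite divr_ge0// ?(ltW c0)//; case/andP: tp.
rewrite ler_pdivlMr// in jt; rewrite ltr_pdivrMr// -natr1 mulrDl mul1r in tj.
pose t' := t - j%:R * c.
have t'c : 0 <= t' <= c by rewrite /t'; apply/andP; split; lra.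
have UE : U (r%:C * expi t) = \sum_(k < N) phi (t' + k%:R * c).
  have -> : t = j%:R * c + t' by rewrite addrC subrK.
  rewrite expiD mulrCA Uj /U; apply: eq_bigr => k _.
  by rewrite mulrCA -expiD addrC.
have U0 : U 0 = N%:R * u 0.
  rewrite /U (eq_bigr (fun=> u 0)) => [|k _]; last by rewrite mulr0.
  by rewrite sumr_const card_ord mulr_natl.
have Hd' x y : x \in `[0, N%:R * c] -> `|y - x| <= c -> `|phi y - phi x| < e.
  by rewrite cN => xp yx; apply: Hd => //; exact: le_lt_trans nd.
have := riemann_sum_le phic c0 t'c Hd'.
rewrite -mulr_suml sumrB -UE sumr_const card_ord cN -[e *+ N]mulr_natl => RS.
have ec : e * c <= e * (2 * pi).
  by rewrite ler_wpM2l ?(ltW e1)// -cN ler_peMl ?(ltW c0)// ler1n.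
have : c * (U 0) <= c * (U (r%:C * expi t) + e) by rewrite ler_wpM2l// ltW.
have -> : c * U 0 = 2 * pi * u 0 by rewrite U0 mulrA (mulrC c) cN.
move=> H; apply: (le_trans H).
have e4 : e * (4 * pi) = e0 by rewrite divfK// mulf_neq0 ?pnatr_eq0// gt_eqF ?pi_gt0.
have -> : c * (U (r%:C * expi t) + e) =
  (U (r%:C * expi t) - N%:R * e) * c + (N%:R * c) * e + e * c by ring.
rewrite cN; apply: (@le_trans _ _ (\int[lebesgue_measure]_(x in `[0, 2 * pi]) phi x +
    2 * pi * e + e * (2 * pi))).
  by rewrite lerD// lerD2r.
by rewrite -addrA lerD2l -e4; lra.
Qed.

(** * Four-point inequalities for Re f and ln |f| *)

Lemma ln_le_subr1 (R : realType) (x : R) : 0 < x -> ln x <= x - 1.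
Proof.
move=> x0; have := expR_ge1Dx (ln x); rewrite lnK ?posrE//; lra.
Qed.

Lemma ii_sqr (R : realType) : 'i%C * 'i%C = -1 :> R[i].
Proof. by rewrite -expr2 sqr_i. Qed.

Lemma normc_ih (R : realType) (h : R[i]) : normc ('i%C * h) = normc h.
Proof. by rewrite normcM normci mul1r. Qed.

(** The cubes of -1, i and -i are moved into the remainders, which keeps the common bound C. The
    condition d <= 1 lets later estimates bound every power of |h| by 1. *)
Lemma taylor2_points (R : realType) (f : R[i] -> R[i]) z0 : taylor2 f z0 ->
  exists a1 a2 (d C : R), [/\ 0 < d, d <= 1, 0 <= C &
    forall h, normc h < d -> exists r1 r2 r3 r4,
      [/\ normc r1 <= C, normc r2 <= C, normc r3 <= C & normc r4 <= C] /\
      [/\ f (z0 + h) = f z0 + a1 * h + a2 * h ^+ 2 + r1 * h ^+ 3,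
          f (z0 - h) = f z0 - a1 * h + a2 * h ^+ 2 + r2 * h ^+ 3,
          f (z0 + 'i%C * h) = f z0 + 'i%C * a1 * h - a2 * h ^+ 2 + r3 * h ^+ 3 &
          f (z0 - 'i%C * h) = f z0 - 'i%C * a1 * h - a2 * h ^+ 2 + r4 * h ^+ 3]].
Proof.
move=> [a1 [a2 [rho [C [rho0 H]]]]].
have C0 : 0 <= C.
  by have [|r rC _] := H 0; rewrite ?normc0//; exact: le_trans (normc_ge0 _) rC.
exists a1, a2, (Num.min rho 1), C; split => //.
- by rewrite lt_min rho0 ltr01.
- by rewrite ge_min lexx orbT.
move=> h; rewrite lt_min => /andP[hr _].
have [r1 r1C E1] := H _ hr.
have [|r2 r2C E2] := H (- h); first by rewrite normcNE.
have [|r3 r3C E3] := H ('i%C * h); first by rewrite normc_ih.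
have [|r4 r4C E4] := H (- ('i%C * h)); first by rewrite normcNE normc_ih.
exists r1, (- r2), (- 'i%C * r3), ('i%C * r4); split.
  by split; rewrite ?normcM ?normcNE ?normci ?mul1r.
have i2 := @ii_sqr R; split => //.
- by rewrite E2; ring.
- rewrite E3; have -> : ('i%C * h) ^+ 3 = ('i%C * 'i%C) * 'i%C * h ^+ 3 by ring.
  have -> : ('i%C * h) ^+ 2 = ('i%C * 'i%C) * h ^+ 2 by ring.
  by rewrite i2; ring.
- rewrite E4; have -> : (- ('i%C * h)) ^+ 3 = - ('i%C * 'i%C) * 'i%C * h ^+ 3 by ring.
  have -> : (- ('i%C * h)) ^+ 2 = ('i%C * 'i%C) * h ^+ 2 by ring.
  by rewrite i2; ring.
Qed.

Lemma small_cubic (R : realType) (K eta : R) : 0 <= K -> 0 < eta ->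
  exists2 d, 0 < d & forall x, 0 <= x -> x < d -> K * x ^+ 3 <= eta * x ^+ 2.
Proof.
move=> K0 eta0; have K1 : 0 < K + 1 by rewrite ltr_wpDl.
exists (eta / (K + 1)); first by rewrite divr_gt0.
move=> x x0; rewrite ltr_pdivlMr// => H.
rewrite exprS mulrA ler_wpM2r ?exprn_ge0//; lra.
Qed.

(** The sums of i^k and of i^(2k) over k < 4 both vanish, so only the four cubic remainders survive.
    The minus sign is the direction that bounds Re f(0) from below by a circular mean. *)
Lemma submean_Re (R : realType) (f : R[i] -> R[i]) z0 : taylor2 f z0 ->
  submean (fun z => - complex.Re (f z)) z0.
Proof.
move=> /taylor2_points[a1 [a2 [d [C [d0 d1 C0 H]]]]] eta eta0.
have [|d' d'0 Hd'] := @small_cubic _ (4 * C) _ _ eta0; first by rewrite mulr_ge0.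
exists (Num.min d d'); first by rewrite lt_min d0.
move=> h; rewrite lt_min => /andP[/H hd /(Hd' _ (normc_ge0 h))].
move: hd => [r1 [r2 [r3 [r4 [[n1 n2 n3 n4] [E1 E2 E3 E4]]]]]] Hh.
have : complex.Re (f (z0 + h) + f (z0 - h) + f (z0 + 'i%C * h) + f (z0 - 'i%C * h)
          - 4 * f z0) <= 4 * C * normc h ^+ 3.
  rewrite E1 E2 E3 E4; set w := _ - _.
  have -> : w = (r1 + r2 + r3 + r4) * h ^+ 3 by rewrite /w; ring.
  apply: (le_trans (ler_norm _)); apply: (le_trans (normr_Re_le _)).
  rewrite normcM normcX ler_wpM2r ?exprn_ge0 ?normc_ge0//.
  have := normcD_le (r1 + r2 + r3) r4; have := normcD_le (r1 + r2) r3.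
  have := normcD_le r1 r2; lra.
have -> : 4 * f z0 = f z0 + f z0 + f z0 + f z0 by ring.
move: (f z0) (f (z0 + h)) (f (z0 - h)) (f (z0 + 'i%C * h)) (f (z0 - 'i%C * h)).
move=> [? ?] [? ?] [? ?] [? ?] [? ?] /=; lra.
Qed.

(* Second-order terms cancel: (1 + b1 h + b2 h^2)(1 - b1 h + b2 h^2) is
   1 + (2 b2 - b1^2) h^2 + O(h^4), and replacing h by ih flips the sign. *)
Lemma taylor2_prod4 (R : realType) (q : R[i] -> R[i]) z0 : taylor2 q z0 -> q z0 = 1 ->
  exists d K : R, [/\ 0 < d, 0 <= K & forall h, normc h < d ->
    exists2 E, normc E <= K &
    q (z0 + h) * q (z0 - h) * q (z0 + 'i%C * h) * q (z0 - 'i%C * h) = 1 + E * h ^+ 3].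
Proof.
move=> /taylor2_points[b1 [b2 [d [C [d0 d1 C0 H]]]]] q1.
pose c := b2 *+ 2 - b1 ^+ 2.
(* M bounds each of the four factors, with or without its cubic remainder. Removing the remainders
   one factor at a time leaves four terms of size C M^3, and K0 bounds what the product of the
   quadratic parts contributes. *)
pose M := 1 + normc b1 + normc b2 + C.
pose K0 := normc (b2 ^+ 2 *+ 2 - c ^+ 2) + normc (b2 ^+ 4).
have nb1 := normc_ge0 b1; have nb2 := normc_ge0 b2.
have M0 : 0 <= M by rewrite /M; lra.
exists d, (4 * (C * M ^+ 3) + K0); split => //.
  by rewrite !addr_ge0 ?normc_ge0// mulr_ge0// mulr_ge0// exprn_ge0.
move=> h hd; have [r1 [r2 [r3 [r4 [[n1 n2 n3 n4] []]]]]] := H _ hd.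
rewrite q1 => E1 E2 E3 E4.
have h1 : normc h <= 1 by rewrite (le_trans (ltW hd)).
have hn n : normc (h ^+ n) <= 1 by rewrite normcX exprn_ile1// normc_ge0.
have small (w b : R[i]) : normc w <= 1 -> normc (w * b) <= normc b.
  by move=> w1; rewrite normcM ler_piMl// normc_ge0.
have small2 (w b : R[i]) n : normc w <= 1 -> normc (w * h ^+ n * b) <= normc b.
  move=> w1; apply: small; rewrite normcM mulr_ile1// ?normc_ge0//.
pose p (w : R[i]) := 1 + w * h ^+ 1 * b1 + w ^+ 2 * h ^+ 2 * b2.
have pM w : normc w = 1 -> normc (p w) <= 1 + normc b1 + normc b2.
  move=> w1.
  have := normcD_le (1 + w * h ^+ 1 * b1) (w ^+ 2 * h ^+ 2 * b2).
  have := normcD_le 1 (w * h ^+ 1 * b1); rewrite normc1.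
  have := @small2 w b1 1; rewrite w1 => /(_ (lexx _)).
  have := @small2 (w ^+ 2) b2 2; rewrite normcX w1 expr1n => /(_ (lexx _)).
  rewrite /p; lra.
have qM w r : normc w = 1 -> normc r <= C -> normc (p w + r * h ^+ 3) <= M.
  move=> w1 rC; apply: (le_trans (normcD_le _ _)); rewrite /M lerD ?pM//.
  by have := small (h ^+ 3) r (hn 3%N); rewrite mulrC => /le_trans; apply.
have pM' w : normc w = 1 -> normc (p w) <= M.
  by move=> w1; rewrite (le_trans (pM _ w1))// /M lerDl.
have i2 := @ii_sqr R.
have ni1 : normc (- 'i%C : R[i]) = 1 by rewrite normcNE normci.
have nN1 : normc (- 1 : R[i]) = 1 by rewrite normcNE normc1.
have n11 : normc (1 : R[i]) = 1 by rewrite normc1.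
have {}E1 : q (z0 + h) = p 1 + r1 * h ^+ 3 by rewrite E1 /p; ring.
have {}E2 : q (z0 - h) = p (-1) + r2 * h ^+ 3 by rewrite E2 /p; ring.
have {}E3 : q (z0 + 'i%C * h) = p 'i%C + r3 * h ^+ 3 by rewrite E3 /p sqr_i; ring.
have {}E4 : q (z0 - 'i%C * h) = p (- 'i%C) + r4 * h ^+ 3.
  by rewrite E4 /p sqrrN sqr_i; ring.
have pp : p 1 * p (-1) * p 'i%C * p (- 'i%C) =
    1 + ((b2 ^+ 2 *+ 2 - c ^+ 2) * h + b2 ^+ 4 * h ^+ 5) * h ^+ 3.
  have -> : p 1 * p (-1) * p 'i%C * p (- 'i%C) =
      p 1 * p (-1) * ((1 + 'i%C * 'i%C * h ^+ 2 * b2) ^+ 2 - ('i%C * 'i%C) * h ^+ 2 * b1 ^+ 2).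
    by rewrite /p; ring.
  by rewrite i2 /p /c; ring.
exists (r1 * (p (-1) + r2 * h ^+ 3) * (p 'i%C + r3 * h ^+ 3) * (p (- 'i%C) + r4 * h ^+ 3)
  + r2 * p 1 * (p 'i%C + r3 * h ^+ 3) * (p (- 'i%C) + r4 * h ^+ 3)
  + r3 * p 1 * p (-1) * (p (- 'i%C) + r4 * h ^+ 3)
  + r4 * p 1 * p (-1) * p 'i%C
  + ((b2 ^+ 2 *+ 2 - c ^+ 2) * h + b2 ^+ 4 * h ^+ 5)); last first.
  rewrite mulrDl addrCA -pp E1 E2 E3 E4.
  by move: (p 1) (p (-1)) (p 'i%C) (p (- 'i%C)) => ? ? ? ?; ring.
have bd a x y z : normc a <= C -> normc x <= M -> normc y <= M -> normc z <= M ->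
    normc (a * x * y * z) <= C * M ^+ 3.
  move=> aC xM yM zM; rewrite !normcM -!mulrA !exprS expr0 mulr1.
  by do !(apply: ler_pM => //; rewrite ?mulr_ge0 ?normc_ge0//).
apply: (le_trans (normcD_le _ _)); apply: lerD; last first.
  apply: (le_trans (normcD_le _ _)); rewrite /K0 ![_ * h]mulrC ![_ * h ^+ 5]mulrC.
  by rewrite lerD// small.
have -> : 4 * (C * M ^+ 3) = C * M ^+ 3 + C * M ^+ 3 + C * M ^+ 3 + C * M ^+ 3 by ring.
do 3!(apply: (le_trans (normcD_le _ _)); apply: lerD; last first;
  [by apply: bd; auto using normci|]).
by apply: bd; auto using normci.
Qed.

(* By Cauchy-Schwarz (|f|^2 + delta) D0 >= |f (f z0)^* + delta|^2 with equality at
   z0, where D0 = |f z0|^2 + delta; near z0 the right-hand side is the square of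
   the modulus of a nonvanishing analytic function. *)
Lemma submean_ln (R : realType) (f : R[i] -> R[i]) (delta : R) z0 :
  0 < delta -> taylor2 f z0 -> submean (fun z => ln (normc (f z) ^+ 2 + delta)) z0.
Proof.
move=> delta0 fq eta eta0.
pose D0 := normc (f z0) ^+ 2 + delta.
have v0 (a : R[i]) : 0 < normc a ^+ 2 + delta by rewrite ltr_wpDl// exprn_ge0// normc_ge0.
have D00 : 0 < D0 by exact: v0.
have D0C : (D0%:C : R[i]) != 0 by rewrite (inj_eq (@complexI R) D0 0) gt_eqF.
have ffJ : f z0 * (f z0)^* = (normc (f z0) ^+ 2)%:C.
  rewrite normc_sqrE; case: (f z0) => a b; apply/eqP; rewrite eq_complex /=.
  by apply/andP; split; apply/eqP; ring.
pose q z := (f z * (f z0)^* + delta%:C) / D0%:C.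
have q1 : q z0 = 1 by rewrite /q ffJ -rmorphD/= divff.
have qq : taylor2 q z0.
  move: fq => [a1 [a2 [rho [C [rho0 H]]]]].
  pose k := (f z0)^* / D0%:C.
  exists (a1 * k), (a2 * k), rho, (C * normc k); split => //.
  move=> h /H[r rC E]; exists (r * k).
    by rewrite normcM ler_wpM2r// normc_ge0.
  by rewrite /q E /k; ring.
have [d [K [d0 K0 H]]] := taylor2_prod4 qq q1.
have K40 : 0 <= 4 * K by rewrite mulr_ge0.
(* With B = K |h|^3, d1 yields 4 B <= eta |h|^2, and d2 together with |h| < 1 yields 4 B <= 1, which
   makes ln (1 - B) >= -2 B. Hence 2 ln (1 - B) >= - eta |h|^2. *)
have [d1 d10 Hd1] := small_cubic K40 eta0.
have [d2 d20 Hd2] := small_cubic K40 (@ltr01 R).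
exists (Num.min d (Num.min d1 (Num.min d2 1))).
  by rewrite !lt_min d0 d10 d20 ltr01.
move=> h; rewrite !lt_min => /and4P[/H[E EK Eq] hd1 hd2 h1].
have h0 := normc_ge0 h.
have {}Hd1 := Hd1 _ h0 hd1; have {}Hd2 := Hd2 _ h0 hd2.
have CS z : D0 * normc (q z) ^+ 2 <= normc (f z) ^+ 2 + delta.
  rewrite /q normcM normcV normc_real (gtr0_norm D00) exprMn exprVn.
  have -> : forall W, D0 * (W * (D0 ^+ 2)^-1) = W / D0.
    by move=> W; rewrite expr2; field; rewrite gt_eqF.
  rewrite ler_pdivrMr// /D0 !normc_sqrE; case: (f z) (f z0) => a b [c e] /=.
  rewrite -subr_ge0.
  suff -> : (a ^+ 2 + b ^+ 2 + delta) * (c ^+ 2 + e ^+ 2 + delta) -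
     ((a * c - b * - e + delta) ^+ 2 + (a * - e + b * c + 0) ^+ 2) =
     delta * ((a - c) ^+ 2 + (b - e) ^+ 2).
    by rewrite mulr_ge0 ?addr_ge0 ?sqr_ge0// ltW.
  by ring.
pose w z := normc (f z) ^+ 2 + delta.
set x1 := z0 + h; set x2 := z0 - h; set x3 := z0 + _; set x4 := z0 - _.
rewrite -/x1 -/x2 -/x3 -/x4 in Eq.
have Q : normc (q x1 * q x2 * q x3 * q x4) >= 1 - K * normc h ^+ 3.
  rewrite Eq lerBlDr -{1}normc1.
  have {1}-> : (1 : R[i]) = (1 + E * h ^+ 3) - E * h ^+ 3 by ring.
  apply: (le_trans (normcB_le _ _)); rewrite lerD2l normcM normcX ler_wpM2r//.
  by rewrite exprn_ge0.
set B := K * normc h ^+ 3 in Q.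
have B0 : 0 <= B by rewrite mulr_ge0// exprn_ge0.
have B4 : 4 * B <= 1.
  rewrite /B mulrA (le_trans Hd2)// mul1r exprn_ile1//; exact: ltW.
have Bh : 4 * B <= eta * normc h ^+ 2 by rewrite /B mulrA.
have y0 : 0 < 1 - B by lra.
have lny : - (2 * B) <= ln (1 - B).
  have yV : 0 < (1 - B)^-1 by rewrite invr_gt0.
  have := ln_le_subr1 yV; rewrite lnV ?posrE//.
  have : (1 - B)^-1 <= 1 + 2 * B by rewrite -[leLHS]mul1r ler_pdivrMr//; nra.
  lra.
(* The four logarithms are added by multiplying their arguments: the product of the |q|^2 is the
   squared modulus of a single complex number close to 1, so q itself need not be given a
   logarithm. *)
have prodw : D0 ^+ 4 * (1 - B) ^+ 2 <= w x1 * w x2 * w x3 * w x4.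
  have : D0 * normc (q x1) ^+ 2 * (D0 * normc (q x2) ^+ 2) *
      (D0 * normc (q x3) ^+ 2) * (D0 * normc (q x4) ^+ 2) <= w x1 * w x2 * w x3 * w x4.
    have qp x : 0 <= D0 * normc (q x) ^+ 2.
      by rewrite mulr_ge0 ?exprn_ge0 ?normc_ge0// ltW.
    have qp2 := mulr_ge0 (qp x1) (qp x2).
    apply: ler_pM; [exact: mulr_ge0 qp2 (qp x3)|exact: qp| |exact: CS].
    apply: ler_pM; [exact: qp2|exact: qp| |exact: CS].
    by apply: ler_pM; [exact: qp|exact: qp|exact: CS|exact: CS].
  apply: le_trans.
  have -> : D0 * normc (q x1) ^+ 2 * (D0 * normc (q x2) ^+ 2) *
      (D0 * normc (q x3) ^+ 2) * (D0 * normc (q x4) ^+ 2) =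
      D0 ^+ 4 * normc (q x1 * q x2 * q x3 * q x4) ^+ 2.
    by rewrite !normcM; ring.
  rewrite ler_wpM2l ?exprn_ge0 ?(ltW D00)// lerXn2r// nnegrE ?normc_ge0//; exact: ltW.
have w0 x : 0 < w x by exact: v0.
have {}prodw : ln (D0 ^+ 4 * (1 - B) ^+ 2) <= ln (w x1 * w x2 * w x3 * w x4).
  by rewrite ler_ln ?posrE ?mulr_gt0 ?exprn_gt0.
move: prodw.
have -> : ln (D0 ^+ 4 * (1 - B) ^+ 2) = 4 * ln D0 + 2 * ln (1 - B).
  by rewrite lnM ?posrE ?exprn_gt0// !lnXn// !mulr_natl.
rewrite !lnM ?posrE ?mulr_gt0//.
rewrite -/D0 -/(w x1) -/(w x2) -/(w x3) -/(w x4) => H1.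
apply: (le_trans _ (lerD H1 Bh)).
move: lny; set l1 := ln D0; set l2 := ln (1 - B); lra.
Qed.

(** * Integration against the completed Lebesgue measure *)

(* The library defines the integral of a nonnegative function as a supremum over
   simple functions, so it is monotone even on nonmeasurable functions; the
   boundary function is never shown to be measurable. *)
Lemma ge0_le_integral_nonmeasurable d (T : measurableType d) (R : realType)
    (mu : {measure set T -> \bar R}) (D : set T) (f g : T -> \bar R) :
  (forall x, D x -> 0 <= f x)%E -> (forall x, D x -> f x <= g x)%E ->
  (\int[mu]_(x in D) f x <= \int[mu]_(x in D) g x)%E.
Proof.
move=> f0 fg; have g0 x : D x -> (0 <= g x)%E by move=> Dx; apply: le_trans (fg x Dx); exact: f0.
rewrite !ge0_integralE//; apply: ereal_sup_le => _ [h /= hf <-]; exists h => // x.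
apply: (le_trans (hf x)); rewrite /patch; case: ifPn => // xD.
by apply: fg; rewrite inE in xD.
Qed.

(** The integral of f is that of its positive part minus a nonnegative quantity, and the positive
    part stays below g because g is nonnegative. *)
Lemma le_integral_nonmeasurable d (T : measurableType d) (R : realType)
    (mu : {measure set T -> \bar R}) (D : set T) (f g : T -> \bar R) :
  (forall x, D x -> 0 <= g x)%E -> (forall x, D x -> f x <= g x)%E ->
  (\int[mu]_(x in D) f x <= \int[mu]_(x in D) g x)%E.
Proof.
move=> g0 fg; rewrite integralE.
apply: (@le_trans _ _ (\int[mu]_(x in D) f^\+ x)%E).
  rewrite -[leRHS]sube0; apply: leeB => //; exact: integral_ge0.
apply: ge0_le_integral_nonmeasurable => // x Dx.
by rewrite funeposE ge_max fg//= g0.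
Qed.

Section completed.
Variable R : realType.
Notation lam := (@lebesgue_measure R).
Notation mu := (@completed_lebesgue_measure R).
Let C := caratheodory_type (wlength (@idfun R))^*%mu.

Lemma borel_completed (D : set R) : measurable D -> measurable (D : set C).
Proof. by move=> mD; apply: sub_caratheodory. Qed.

Lemma measurable_id_completed : measurable_fun setT (idfun : C -> measurableTypeR R).
Proof. by move=> _ D mD; rewrite setTI preimage_id; exact: borel_completed. Qed.

Lemma measurable_fun_completed d (T : measurableType d) (D : set R) (g : R -> T) :
  measurable D -> measurable_fun D g ->
  measurable_fun (D : set C) (g : C -> T).
Proof.
by move=> mD mg _ Y mY; apply: borel_completed; exact: mg.
Qed.

(** Both measures are the same set function, the Lebesgue outer measure; they differ in their
    sigma-algebras. *)
Lemma completed_lebesgueE (D : set R) : mu D = lam D.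
Proof. by []. Qed.

(** The identity is measurable from the completed to the Borel structure and pushes the completed
    measure forward to the Lebesgue measure, so this is a change of variables. *)
Lemma ge0_completed_integral (D : set R) (g : R -> \bar R) :
  measurable D -> measurable_fun D g ->
  (forall x, D x -> 0 <= g x)%E ->
  (\int[mu]_(x in D) g x = \int[lam]_(x in D) g x)%E.
Proof.
move=> mD mg g0.
have := @ge0_integral_pushforward _ _ C (measurableTypeR R) R idfun
  measurable_id_completed mu D g mD mg.
rewrite preimage_id => <-; last by move=> x /[!inE]; exact: g0.
by apply: eq_measure_integral => [|mid E mE _]; first exact: measurable_id_completed.
Qed.

Lemma continuous_completed_integrable (phi : R -> R) (a b : R) :
  continuous phi -> mu.-integrable `[a, b] (EFin \o phi).
Proof.
move=> phic; have /integrableP[mphi iphi] := continuous_itv_integrable a b phic.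
apply/integrableP; split; first exact: measurable_fun_completed.
rewrite (ge0_completed_integral (g := fun x => `|(EFin \o phi) x|%E))//.
exact: measurableT_comp.
Qed.

Lemma completed_Rintegral (phi : R -> R) (a b : R) :
  continuous phi ->
  \int[mu]_(x in `[a, b]) phi x = \int[lam]_(x in `[a, b]) phi x.
Proof.
move=> phic; congr fine.
have /integrableP[mphi iphi] := continuous_itv_integrable a b phic.
rewrite [LHS]integralE [RHS]integralE; congr (_ - _)%E.
  by apply: ge0_completed_integral => //; exact: measurable_funepos.
by apply: ge0_completed_integral => //; exact: measurable_funeneg.
Qed.

End completed.

(** * Integrands on a circle of fixed radius *)

Lemma continuous_circle (R : realType) (f : R[i] -> R[i]) (r : R) :
  analytic_on (@unit_disc R) f -> 0 < r < 1 ->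
  continuous (fun t : R => f (r%:C * expi t) : R[i]^o).
Proof.
move=> fa /andP[r0 r1] t.
apply: (@cvg_comp _ _ _ (fun t => r%:C * expi t) f (nbhs t) (nbhs (r%:C * expi t : R[i]^o))).
  apply: (@cvg_comp _ _ _ (@expi R) ( *%R r%:C) (nbhs t) (nbhs (expi t : R[i]^o))).
    exact: continuous_expi.
  exact: (@mulrl_continuous R[i] r%:C (expi t)).
apply: taylor2_continuous; apply: (analytic_taylor2 fa).
by rewrite /unit_disc/= normcM normc_expi mulr1 normc_real gtr0_norm.
Qed.

Lemma continuous_circle_normc (R : realType) (f : R[i] -> R[i]) (r : R) :
  analytic_on (@unit_disc R) f -> 0 < r < 1 ->
  continuous (fun t : R => normc (f (r%:C * expi t))).
Proof.
move=> fa r01 t.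
apply: (@cvg_comp _ _ _ (fun t => f (r%:C * expi t)) (@normc R) (nbhs t)
  (nbhs (f (r%:C * expi t) : R[i]^o))); last exact: continuous_normc.
exact: continuous_circle.

Qed.

Lemma continuous_circle_Re (R : realType) (f : R[i] -> R[i]) (r : R) :
  analytic_on (@unit_disc R) f -> 0 < r < 1 ->
  continuous (fun t : R => complex.Re (f (r%:C * expi t))).
Proof.
move=> fa r01 t.
apply: (@cvg_comp _ _ _ (fun t => f (r%:C * expi t)) (@complex.Re R) (nbhs t)
  (nbhs (f (r%:C * expi t) : R[i]^o))); last exact: continuous_Re.
exact: continuous_circle.

Qed.

(** Serves the two majorants of [radial_bound], which are linear in |f_r|, in (Re f_r)^+ cut off to
    A, and in the indicator of A. *)
Lemma Rintegral_lin3 d (T : measurableType d) (R : realType)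
    (mu : {measure set T -> \bar R}) (D : set T) (g1 g2 g3 : T -> R) (a b c e M : R) :
  measurable D -> mu D = M%:E ->
  mu.-integrable D (EFin \o g1) -> mu.-integrable D (EFin \o g2) ->
  mu.-integrable D (EFin \o g3) ->
  mu.-integrable D (EFin \o (fun x => a * g1 x + b * g2 x + c * g3 x + e)) /\
  \int[mu]_(x in D) (a * g1 x + b * g2 x + c * g3 x + e) =
  a * \int[mu]_(x in D) g1 x + b * \int[mu]_(x in D) g2 x +
  c * \int[mu]_(x in D) g3 x + e * M.
Proof.
move=> mD DM i1 i2 i3; have Dfin : (mu D < +oo)%E by rewrite DM ltry.
have iZ k g : mu.-integrable D (EFin \o g) -> mu.-integrable D (EFin \o (fun x => k * g x)).
  by move=> ig; have := integrableZl mD k ig; apply: eq_integrable.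
have iD g h : mu.-integrable D (EFin \o g) -> mu.-integrable D (EFin \o h) ->
    mu.-integrable D (EFin \o (fun x => g x + h x)).
  by move=> ig ih; have := integrableD mD ig ih; apply: eq_integrable.
have ie : mu.-integrable D (EFin \o (fun=> e)).
  apply: measurable_bounded_integrable => //.
  by exists `|e|; split; [exact: num_real|move=> x ex y _; exact: ltW].
have j1 := iZ a _ i1; have j2 := iZ b _ i2; have j3 := iZ c _ i3.
have j12 := iD _ _ j1 j2; have j123 := iD _ _ j12 j3.
split; first exact: iD _ _ j123 ie.
rewrite RintegralD// RintegralD// RintegralD//.
by rewrite !RintegralZl// Rintegral_cst// DM.
Qed.

(** * The weighted Jensen estimate on a circle *)

(* The tangent-line bound ln y <= y - 1 at y = (n + tau) w / c plays the role of
   Jensen's inequality for the weight w, equal to gamma on A and to 1 elsewhere. *)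
Lemma ln_weight_le (R : realType) (n tau c w : R) :
  0 <= n -> 0 < tau -> 0 < c -> 0 < w ->
  ln (n ^+ 2 + tau ^+ 2) <= 2 * ((n + tau) * w / c - 1 + ln c - ln w).
Proof.
move=> n0 tau0 c0 w0; have Nt : 0 < n + tau by rewrite ltr_wpDl.
have : ln (n ^+ 2 + tau ^+ 2) <= 2 * ln (n + tau).
  have -> : 2 * ln (n + tau) = ln ((n + tau) ^+ 2) by rewrite lnXn// mulr_natl.
  rewrite ler_ln ?posrE ?exprn_gt0//; last by rewrite ltr_wpDl ?exprn_ge0 ?exprn_gt0.
  by rewrite sqrrD lerD2r lerDl mulrn_wge0// mulr_ge0// ltW.
have := @ln_le_subr1 _ ((n + tau) * w / c).
rewrite !divr_gt0 ?mulr_gt0// => /(_ isT).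
rewrite lnM ?posrE ?mulr_gt0 ?invr_gt0// lnM ?posrE// lnV ?posrE//; lra.
Qed.

(** This is the case of a point of A, with p = (Re f_r)^+. The weighted value gamma n = n - (1 -
    gamma) n is at most n - (1 - gamma) p, which brings in the integral known to be large. The final
    factor 1 is the indicator of A, replaced by 0 in [ln_weight_lin0]. *)
Lemma ln_weight_lin (R : realType) (n tau c gamma p : R) :
  0 <= n -> 0 < tau -> 0 < c -> 0 < gamma < 1 -> p <= n ->
  ln (n ^+ 2 + tau ^+ 2) <=
    2 / c * n + - (2 * (1 - gamma) / c) * p + - (2 * ln gamma) * 1 +
    2 * (tau / c - 1 + ln c).
Proof.
move=> n0 tau0 c0 /andP[g0 g1] pn.
apply: (le_trans (ln_weight_le n0 tau0 c0 g0)).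
have : (n + tau) * gamma / c <= (n + tau - (1 - gamma) * p) / c.
  by rewrite ler_pM2r ?invr_gt0//; nra.
have -> : 2 / c * n + - (2 * (1 - gamma) / c) * p + - (2 * ln gamma) * 1 +
  2 * (tau / c - 1 + ln c) =
  2 * ((n + tau - (1 - gamma) * p) / c - 1 + ln c - ln gamma) by ring.
lra.
Qed.

Lemma ln_weight_lin0 (R : realType) (n tau c k l : R) :
  0 <= n -> 0 < tau -> 0 < c ->
  ln (n ^+ 2 + tau ^+ 2) <=
    2 / c * n + k * 0 + l * 0 + 2 * (tau / c - 1 + ln c).
Proof.
move=> n0 tau0 c0; apply: (le_trans (ln_weight_le n0 tau0 c0 (@ltr01 R))).
by rewrite ln1 !mulr0 !addr0 subr0 le_eqVlt; apply/orP; left; apply/eqP; ring.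
Qed.

(** For x >= 0, -x = x - 2 x <= n - 2 x. The null terms give the bound the shape of
    [Rintegral_lin3]. *)
Lemma opp_le_max0 (R : realType) (x n o : R) : x <= n ->
  - x <= n -> - x <= 1 * n + -2 * Num.max x 0 + 0 * o + 0.
Proof. by move=> xn xn'; case: (leP x 0) => ?; lra. Qed.

(** In the three [deficit] lemmas D is 2 pi, IN the integral of |f_r|, and P the integral of (Re
    f_r)^+ over A. *)
Lemma deficit_ge0 (R : realType) (D P e : R) : 0 < D ->
  D * (1 - e) <= P -> P <= D -> 0 <= e.
Proof. by move=> D0 H1 H2; have := le_trans H1 H2; rewrite -[leRHS]mulr1 ler_pM2l//; lra. Qed.

Lemma deficit_Re (R : realType) (D IN P e x : R) : 0 < D ->
  D * (1 - e) <= P -> IN <= D -> D * - x <= IN + -2 * P -> 1 - 2 * e <= x.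
Proof.
move=> D0 H1 H2 H3; have : D * (1 - 2 * e) <= D * x by lra.
by rewrite ler_pM2l.
Qed.

(** Here lg, l0 and l1 stand for ln gamma, ln c and ln (1 - 2 e), and m for the measure of A. The
    tangent point c bounds the mean of (|f_r| + tau) w from above, so the linear term integrates to
    at most D and is cancelled by the -1 of ln y <= y - 1. *)
Lemma deficit_ln (R : realType) (D IN P e tau gamma c lg l0 l1 m : R) :
  0 < D -> D * (1 - e) <= P -> IN <= D -> gamma < 1 ->
  c = 1 + tau - (1 - gamma) * (1 - e) -> 0 < c ->
  D * (2 * l1) <= 2 / c * IN + - (2 * (1 - gamma) / c) * P + - (2 * lg) * m +
    2 * (tau / c - 1 + l0) * D ->
  l1 <= l0 - m / D * lg.
Proof.
move=> D0 DP IND g1 cE c0.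
have -> : 2 / c * IN + - (2 * (1 - gamma) / c) * P + - (2 * lg) * m +
    2 * (tau / c - 1 + l0) * D =
    2 * ((IN + D * tau - (1 - gamma) * P) / c + D * (l0 - 1) - lg * m) by ring.
have : (IN + D * tau - (1 - gamma) * P) / c <= D.
  rewrite ler_pdivrMr// cE.
  have : (1 - gamma) * (D * (1 - e)) <= (1 - gamma) * P.
    by rewrite ler_wpM2l//; lra.
  lra.
move=> H1 H2; rewrite -(ler_pM2l D0).
have -> : D * (l0 - m / D * lg) = D * l0 - lg * m by field; rewrite gt_eqF.
lra.
Qed.

(** The middle term equals gamma + (1 - gamma) e + tau. *)
Lemma weight_bounds (R : realType) (e tau gamma : R) :
  0 <= e -> 0 < tau -> 0 < gamma < 1 ->
  0 < 1 + tau - (1 - gamma) * (1 - e) <= gamma + e + tau.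
Proof. by move=> e0 t0 /andP[g0 g1]; apply/andP; split; nra. Qed.

(** The whole estimate on one circle. The conclusion 0 <= e is exported because the theorem assumes
    no sign for eps. *)
Lemma radial_bound (R : realType) (f : R[i] -> R[i]) (A : set R)
    (r gamma tau e : R) :
  analytic_on (@unit_disc R) f -> 0 < r < 1 ->
  measurable (A : set (caratheodory_type (wlength (@idfun R))^*%mu)) ->
  A `<=` `[0, 2 * pi] ->
  \int[lebesgue_measure]_(t in `[0, 2 * pi]) normc (f (r%:C * expi t)) <= 2 * pi ->
  2 * pi * (1 - e) <= \int[completed_lebesgue_measure]_(t in A)
     Num.max (complex.Re (f (r%:C * expi t))) 0 ->
  0 < gamma < 1 -> 0 < tau -> 0 < 1 - 2 * e ->
  0 <= e /\ ln (1 - 2 * e) <=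
    ln (gamma + e + tau) - fine (completed_lebesgue_measure A) / (2 * pi) * ln gamma.
Proof.
move=> fa r01 mA AI Nle ple g01 tau0 e2; have /andP[g0 g1] := g01.
set mu := (@completed_lebesgue_measure R).
pose C := caratheodory_type (wlength (@idfun R))^*%mu.
set I := `[0, 2 * pi]%classic in AI Nle.
have mI : measurable (I : set C) by apply: borel_completed; exact: measurable_itv.
have p0 : 0 < 2 * pi :> R by rewrite mulr_gt0 ?pi_gt0.
have muI : mu I = (2 * pi)%:E.
  by rewrite [mu I](completed_lebesgueE I) lebesgue_measure_itv/= lte_fin p0 sube0.
pose F t := f (r%:C * expi t).
pose N t := normc (F t); pose X t := complex.Re (F t).
have Nc : continuous N by exact: continuous_circle_normc.
have Xc : continuous X by exact: continuous_circle_Re.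
have iN : mu.-integrable I (EFin \o N) by exact: continuous_completed_integrable.
pose p t := Num.max (X t) 0.
have pc : continuous p.
  by move=> t; apply: (@continuous_max _ _ X (fun=> 0)); [exact: Xc|exact: cvg_cst].
have ip : mu.-integrable I (EFin \o p) by exact: continuous_completed_integrable.
have IA : I `&` A = A by rewrite setIC; apply/setIidPl.
pose pA := p \_ A; pose o := (cst (1 : R)) \_ A.
have restr g : mu.-integrable I (EFin \o g) ->
    mu.-integrable I (EFin \o (g \_ A)) /\
    \int[mu]_(t in I) (g \_ A) t = \int[mu]_(t in A) g t.
  move=> ig; split; last by rewrite -Rintegral_mkcondr IA.
  rewrite -restrict_EFin; apply: (proj1 (integrable_restrict _ mA mI _)); rewrite IA.
  exact: integrableS ig.
have [ipA IpA] := restr _ ip.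
have [io Io] : mu.-integrable I (EFin \o o) /\ \int[mu]_(t in I) o t = fine (mu A).
  have [|io ->] := restr (cst 1).
    apply: (@continuous_completed_integrable _ (cst 1)) => x; exact: cvg_cst.
  by split => //; rewrite Rintegral_cst// mul1r.
have EN : \int[mu]_(t in I) N t <= 2 * pi by rewrite completed_Rintegral.
set P := \int[mu]_(t in A) _ in ple.
have XN t : `|X t| <= N t by exact: normr_Re_le.
have NX t : X t <= N t /\ - X t <= N t.
  by split; apply: le_trans (XN t); [exact: ler_norm|rewrite -normrN ler_norm].
have pAE t : (t \in A /\ pA t = p t /\ o t = 1) \/ (t \notin A /\ pA t = 0 /\ o t = 0).
  rewrite /pA /o /patch; case: ifP => tA; [left|right]; split => //; by rewrite tA.
have N0 t : 0 <= N t by exact: normc_ge0.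
have pN t : p t <= N t by rewrite /p ge_max N0 (proj1 (NX t)).
have e0 : 0 <= e.
  have : \int[mu]_(t in I) pA t <= \int[mu]_(t in I) N t.
    by apply: le_Rintegral => // t _; case: (pAE t) => [[_ [-> _]]|[_ [-> _]]].
  by rewrite IpA -/P => H; exact: deficit_ge0 p0 ple (le_trans H EN).
split=> //.
have uIn z : normc z < 1 -> taylor2 f z by exact: analytic_taylor2 fa.
(* The majorant of -Re f_r: it is |f_r| - 2 (Re f_r)^+ on A and |f_r| elsewhere. *)
have [ia Ea] := Rintegral_lin3 1 (- 2) 0 0 mI muI iN ipA io.
have fquad z : normc z < 1 -> (f : R[i]^o -> R[i]^o) x @[x --> (z : R[i]^o)] --> (f z : R[i]^o).
  by move=> z1; apply: taylor2_continuous; exact: uIn.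
have Re0 : 1 - 2 * e <= complex.Re (f 0).
  have cu z : normc z < 1 -> ccontinuous_at (fun z => - complex.Re (f z)) z.
    move=> z1; apply: (@cvgN _ _ _ (nbhs (z : R[i]^o))).
    by apply: (@cvg_comp _ _ _ f (@complex.Re R) _ (nbhs (f z : R[i]^o)));
      [exact: fquad|exact: continuous_Re].
  have := submean_circle r01 cu (fun z z1 => submean_Re (uIn z z1)).
  rewrite -completed_Rintegral; last by move=> t; apply: cvgN; exact: Xc.
  have : \int[mu]_(t in I) - X t <= \int[mu]_(t in I) (1 * N t + -2 * pA t + 0 * o t + 0).
    apply: le_Rintegral => //.
      by apply: continuous_completed_integrable => t; apply: cvgN; exact: Xc.
    move=> t _; have [? ?] := NX t; case: (pAE t) => [[_ [-> _]]|[_ [-> _]]].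
      exact: opp_le_max0.
    by rewrite mul1r mul0r mulr0 !addr0.
  rewrite Ea mul1r !mul0r !addr0 IpA -/P => H1 H2.
  exact: (deficit_Re p0 ple EN (le_trans H2 H1)).
have nf0 : 1 - 2 * e <= normc (f 0).
  by apply: le_trans Re0 _; apply: le_trans (normr_Re_le _); exact: ler_norm.
pose c := 1 + tau - (1 - gamma) * (1 - e).
have /andP[c0 cle] : 0 < c <= gamma + e + tau by exact: weight_bounds.
(* A regularization of 2 ln |f|; the factor 2 cancels in [deficit_ln]. *)
pose u z := ln (normc (f z) ^+ 2 + tau ^+ 2).
have t20 : 0 < tau ^+ 2 by rewrite exprn_gt0.
have upos z : 0 < normc (f z) ^+ 2 + tau ^+ 2.
  by rewrite ltr_wpDl// exprn_ge0// normc_ge0.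
have cu z : normc z < 1 -> ccontinuous_at u z.
  move=> z1; apply: (@cvg_comp _ _ _ (fun z => normc (f z) ^+ 2 + tau ^+ 2) (@ln R) _
    (nbhs (normc (f z) ^+ 2 + tau ^+ 2))); last exact: continuous_ln.
  apply: (@cvgD _ _ _ (nbhs (z : R[i]^o))); last exact: cvg_cst.
  by apply: (@cvgM _ _ (nbhs (z : R[i]^o)));
   apply: (@cvg_comp _ _ _ f (@normc R) _ (nbhs (f z : R[i]^o)));
      [exact: fquad|exact: continuous_normc|exact: fquad|exact: continuous_normc].
have uc : continuous (fun t => u (r%:C * expi t)).
  move=> t; apply: (@cvg_comp _ _ _ (fun t => N t ^+ 2 + tau ^+ 2) (@ln R) _
    (nbhs (N t ^+ 2 + tau ^+ 2))); last exact: continuous_ln.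
  by apply: cvgD; [apply: cvgM; exact: Nc|exact: cvg_cst].
have := submean_circle r01 cu (fun z z1 => submean_ln t20 (uIn z z1)).
rewrite -completed_Rintegral// -/I.
have [ib Eb] := Rintegral_lin3 (2 / c) (- (2 * (1 - gamma) / c)) (- (2 * ln gamma))
   (2 * (tau / c - 1 + ln c)) mI muI iN ipA io.
have : \int[mu]_(t in I) u (r%:C * expi t) <= \int[mu]_(t in I)
  (2 / c * N t + - (2 * (1 - gamma) / c) * pA t + - (2 * ln gamma) * o t +
   2 * (tau / c - 1 + ln c)).
  apply: le_Rintegral => //; first exact: continuous_completed_integrable.
  move=> t _; rewrite /u -/(F t) -/(N t).
  case: (pAE t) => [[_ [-> ->]]|[_ [-> ->]]].
    exact: ln_weight_lin.
  exact: ln_weight_lin0.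
rewrite Eb IpA -/P Io => H1 H2; have {H1 H2} := le_trans H2 H1.
set m := fine (mu A); set l0 := ln c; set lg := ln gamma.
have lu : 2 * ln (1 - 2 * e) <= u 0.
  have -> : 2 * ln (1 - 2 * e) = ln ((1 - 2 * e) ^+ 2) by rewrite lnXn// mulr_natl.
  rewrite ler_ln ?posrE ?exprn_gt0//.
  rewrite (@le_trans _ _ (normc (f 0) ^+ 2))// ?lerDl ?(ltW t20)//.
  by rewrite lerXn2r// nnegrE ?normc_ge0// ltW.
have lc : l0 <= ln (gamma + e + tau) by rewrite ler_ln ?posrE// (lt_le_trans c0).
move=> H; apply: (le_trans (deficit_ln p0 ple EN g1 (erefl c) c0 (le_trans _ H))).
  by rewrite ler_pM2l.
by rewrite lerD2r.
Qed.

(** * Passage to the boundary *)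

(** The factor 1/2 keeps the radius positive at n = 0, where [harmonic] is 1. *)
Definition radii (R : realType) (n : nat) : R := 1 - harmonic n / 2.

Lemma radii_itv (R : realType) n : 0 < radii R n < 1.
Proof.
have h0 : 0 < harmonic n :> R by rewrite invr_gt0.
have h1 : harmonic n <= 1 :> R by rewrite invf_le1// ler1n.
by rewrite /radii; apply/andP; split; lra.
Qed.

Lemma cvg_radii (R : realType) : radii R n @[n --> \oo] --> (1 : R).
Proof.
have : 1 - harmonic n / 2 @[n --> \oo] --> (1 - 0 / 2 : R).
  by apply: cvgB; [exact: cvg_cst|apply: cvgMl; exact: cvg_harmonic].
by rewrite mul0r subr0.
Qed.

(* Where the radial limit does not exist, [boundary] takes the default value of
   [lim], which is 0; the bound therefore holds at every point of the circle and
   Fatou's theorem on radial limits is not needed. *)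
Lemma boundary_le_liminf (R : realType) (f : R[i] -> R[i]) (w : R[i]) :
  ((Num.max (complex.Re (boundary f w)) 0)%:E <=
   limn_einf (fun n => (Num.max (complex.Re (f ((radii R n)%:C * w))) 0)%:E))%E.
Proof.
set u := (fun n => _).
have [[l fl]|ncv] := pselect (exists l : R[i]^o,
    (f (r%:C * w) : R[i]^o) @[r --> (1 : R)^'-] --> l).
  have -> : boundary f w = l.
    by rewrite /boundary; apply: (@cvg_lim R[i]^o (@norm_hausdorff _ R[i]^o)).
  pose g r := Num.max (complex.Re (f (r%:C * w))) 0.
  have gl : g r @[r --> (1 : R)^'-] --> Num.max (complex.Re l) 0.
    apply: (@cvg_comp _ _ _ (fun r => f (r%:C * w)) (fun z : R[i]^o => Num.max (complex.Re z) 0)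
      _ (nbhs (l : R[i]^o))) => //.
    by apply: (@continuous_max _ _ (@complex.Re R : R[i]^o -> R) (fun=> 0));
      [exact: continuous_Re|exact: (@cvg_cst _ _ _ (nbhs (l : R[i]^o)))].
  have ul : u n @[n --> \oo] --> (Num.max (complex.Re l) 0)%:E.
    apply: cvg_EFin; first exact: nearW.
    move/cvg_at_leftP : gl => /(_ (radii R)); apply; split; last exact: cvg_radii.
    by move=> n; case/andP: (radii_itv R n).
  by rewrite is_cvg_limn_einfE; [rewrite (cvg_lim _ ul)|apply/cvg_ex; eexists; exact: ul].
have -> : boundary f w = 0.
  by rewrite /boundary /lim /lim_in getPN// => l fl; apply: ncv; exists l.
rewrite /= maxxx limn_einf_lim; apply: lime_ge; first exact: is_cvg_einfs.
apply: nearW => n; apply: le_ereal_inf_tmp => _ [k _ <-].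
by rewrite lee_fin le_max lexx orbT.
Qed.

(** If every radius failed, Fatou's lemma along [radii] would bound the boundary integral by c,
    which is less than a. *)
Lemma exists_radius (R : realType) (f : R[i] -> R[i]) (A : set R) (a c : R) :
  analytic_on (@unit_disc R) f ->
  measurable (A : set (caratheodory_type (wlength (@idfun R))^*%mu)) ->
  A `<=` `[0, 2 * pi] -> c < a ->
  (a%:E <= \int[completed_lebesgue_measure]_(t in A)
             (complex.Re (boundary f (expi t)))%:E)%E ->
  exists2 r, 0 < r < 1 & c <= \int[completed_lebesgue_measure]_(t in A)
     Num.max (complex.Re (f (r%:C * expi t))) 0.
Proof.
move=> fa mA AI ca aA; set mu := (@completed_lebesgue_measure R) in aA *.
pose C := caratheodory_type (wlength (@idfun R))^*%mu.
pose p r t := Num.max (complex.Re (f (r%:C * expi t))) 0.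
apply: contrapT => nex.
have ip r : 0 < r < 1 -> mu.-integrable A (EFin \o p r).
  move=> r01; apply: (@integrableS _ C _ mu `[0, 2 * pi]) => //.
    by apply: borel_completed; exact: measurable_itv.
  apply: continuous_completed_integrable => t.
  by apply: (@continuous_max _ _ _ (fun=> 0));
    [exact: continuous_circle_Re|exact: cvg_cst].
have small n : (\int[mu]_(t in A) (p (radii R n) t)%:E <= c%:E)%E.
  have r01 := radii_itv R n.
  rewrite -[leLHS]fineK; last exact: integrable_fin_num (ip _ r01).
  rewrite lee_fin leNgt; apply/negP => H; apply: nex; exists (radii R n) => //.
  exact: ltW.
have p0 r t : 0 <= p r t by rewrite le_max lexx orbT.
have : (a%:E <= c%:E)%E.
  apply: (le_trans aA).
  apply: (@le_trans _ _ (\int[mu]_(t in A) limn_einf (fun n => (p (radii R n) t)%:E))%E).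
    apply: le_integral_nonmeasurable => [t _|t _].
      apply: le_trans (boundary_le_liminf f (expi t)).
      by rewrite lee_fin le_max lexx orbT.
    apply: le_trans (boundary_le_liminf f (expi t)).
    by rewrite lee_fin le_max lexx.
  apply: (le_trans (@fatou _ C _ mu A mA (fun n t => (p (radii R n) t)%:E) _ _)).
  - by move=> n; case/integrableP: (ip _ (radii_itv R n)).
  - by move=> n t _; rewrite lee_fin.
  rewrite limn_einf_lim; apply: lime_le; first exact: is_cvg_einfs.
  apply: nearW => n; apply: (le_trans _ (small n)).
  by apply: ereal_inf_lbound; exists n => //=.
by rewrite lee_fin leNgt ca.
Qed.

(* For 0 < eps, [measure_bound eps] is positive at 1/4, nonpositive beyond
   1 - 3 eps, and tends to 0 at 0, so it suffices to maximize on a segment. *)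
Lemma measure_bound_max (R : realType) (eps : R) : 0 <= eps < 1 / 4 ->
  exists2 g0 : R, 0 < g0 < 1 &
    forall g, 0 < g < 1 -> measure_bound eps g <= measure_bound eps g0.
Proof.
move=> /andP[]; rewrite le_eqVlt => /predU1P[<- _|e0 e4].
  have mb1 (g : R) : 0 < g < 1 -> measure_bound 0 g = 1.
    move=> g01; rewrite /measure_bound addr0 mulr0 subr0 ln1 subr0 divff//.
    by rewrite lt_eqF// ln_lt0.
  have h : 0 < (2^-1 : R) < 1 by rewrite invr_gt0 ltr0n invf_lt1// ltr1n.
  by exists (2^-1 : R) => // g g01; rewrite !mb1.
have e2 : 0 < 1 - 2 * eps by lra.
have q01 : 0 < (1 / 4 : R) < 1 by apply/andP; split; lra.
have lnn (g : R) : 0 < g < 1 -> ln g < 0 by exact: ln_lt0.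
have v0 : 0 < measure_bound eps (1 / 4).
  rewrite /measure_bound nmulr_rgt0 ?invr_lt0 ?lnn// subr_lt0.
  by rewrite ltr_ln ?posrE//; lra.
set v := measure_bound eps (1 / 4) in v0.
(* The numerator of [measure_bound] is at least -K. For g below exp (-K / v), v ln g <= -K, and
   division by the negative ln g makes the quotient at most v. The cap 1/4 keeps the point where v
   is attained inside the segment. *)
pose K := ln (1 - 2 * eps) - ln eps.
pose a := Num.min (1 / 4) (expR (- K / v)).
have a0 : 0 < a by rewrite lt_min expR_gt0 andbT; lra.
have a4 : a <= 1 / 4 by rewrite ge_min lexx.
have ab : a <= 1 - 3 * eps by lra.
have mbc : {within `[a, 1 - 3 * eps], continuous (measure_bound eps)}.
  apply: continuous_in_subspaceT => x; rewrite inE/= in_itv/= => /andP[ax xb].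
  have x01 : 0 < x < 1 by apply/andP; split; lra.
  have /andP[x0 _] := x01.
  apply: cvgM; last first.
    by apply: cvgV; [rewrite lt_eqF// lnn|exact: continuous_ln].
  apply: cvgB; last exact: cvg_cst.
  apply: (@cvg_comp _ _ _ (fun x => x + eps) (@ln R) _ (nbhs (x + eps))).
    by apply: cvgD; [exact: cvg_id|exact: cvg_cst].
  by apply: continuous_ln; lra.
have [c] := EVT_max ab mbc; rewrite in_itv/= => /andP[ac cb] cmax.
have vc : v <= measure_bound eps c.
  by apply: cmax; rewrite in_itv/= a4/=; lra.
exists c; first by apply/andP; split; lra.
move=> g g01; have /andP[g0 g1] := g01.
have lg := lnn _ g01.
have [ga|ag] := ltP g a.
  apply: (le_trans _ vc); rewrite /measure_bound ler_ndivrMr//.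
  have : ln eps <= ln (g + eps) by rewrite ler_ln ?posrE//; lra.
  have : ln g <= - K / v.
    rewrite -ler_expR lnK ?posrE//; apply: (le_trans (ltW ga)).
    by rewrite ge_min lexx orbT.
  rewrite ler_pdivlMr// mulrC /K; lra.
have [gb|bg] := leP g (1 - 3 * eps); first by apply: cmax; rewrite in_itv/= ag.
apply: (le_trans _ vc); rewrite /measure_bound ler_ndivrMr//.
have : ln (1 - 2 * eps) <= ln (g + eps) by rewrite ler_ln ?posrE//; lra.
have : v * ln g <= 0 by rewrite mulr_ge0_le0// ltW.
lra.
Qed.

Lemma H1norm_circle_le (R : realType) (f : R[i] -> R[i]) (r : R) :
  analytic_on (@unit_disc R) f -> H1norm f = 1%E -> 0 < r < 1 ->
  \int[lebesgue_measure]_(t in `[0, 2 * pi]) normc (f (r%:C * expi t)) <= 2 * pi.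
Proof.
move=> fa f1 r01; have p0 : 0 < 2 * pi :> R by rewrite mulr_gt0 ?pi_gt0.
have : ((2 * pi)^-1%:E *
    \int[lebesgue_measure]_(t in `[0%R, (2 * pi)%R]) (normc (f (r%:C * expi t)))%:E <= 1)%E.
  rewrite -f1; apply: ereal_sup_ubound; exists r => //=.
  by case/andP: r01 => /ltW -> ->.
have iN := continuous_itv_integrable 0 (2 * pi) (continuous_circle_normc fa r01).
rewrite -[X in (_ * X)%E]fineK; last exact: integrable_fin_num iN.
by rewrite -EFinM lee_fin mulrC ler_pdivrMr// mul1r.
Qed.

(** * Removal of the auxiliary parameters and conclusion *)

Lemma affine_limit_le (R : realType) (x y k d0 : R) : 0 < d0 -> 0 < k ->
  (forall d, 0 < d -> d <= d0 -> x <= y + d * k) -> x <= y.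
Proof.
move=> d00 k0 H; apply/ler_addgt0Pr => e e0.
have ek : 0 < e / k by rewrite divr_gt0.
have m0 : 0 < Num.min d0 (e / k) by rewrite lt_min d00.
have mle : Num.min d0 (e / k) <= d0 by rewrite ge_min lexx.
apply: (le_trans (H _ m0 mle)); rewrite lerD2l -ler_pdivlMr//.
by rewrite ge_min lexx orbT.
Qed.

(** One d plays both e - eps and tau. After exponentiation the hypothesis is affine in d, with total
    slope 2 + 2 K, so d can tend to 0 by elementary means. The bound 1/16 keeps 1 - 2 (eps + d)
    positive. *)
Lemma measure_bound_le (R : realType) (eps gamma m : R) :
  eps < 1 / 4 -> 0 <= eps -> 0 < gamma < 1 ->
  (forall d, 0 < d -> d <= 1 / 16 -> ln (1 - 2 * (eps + d)) <=
    ln (gamma + (eps + d) + d) - m * ln gamma) ->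
  measure_bound eps gamma <= m.
Proof.
move=> e4 e0 g01 H; have /andP[g0 g1] := g01; have lg : ln gamma < 0 by exact: ln_lt0.
rewrite /measure_bound ler_ndivrMr//.
set K := expR (- (m * ln gamma)); have K0 : 0 < K by exact: expR_gt0.
suff : 1 - 2 * eps <= (gamma + eps) * K.
  have h1 : 0 < 1 - 2 * eps by lra.
  have h2 : 0 < gamma + eps by lra.
  rewrite -ler_ln ?posrE ?mulr_gt0//.
  rewrite lnM ?posrE// expRK; lra.
apply: (@affine_limit_le _ _ _ (2 + 2 * K) (1 / 16)); [lra|lra|move=> d d0 d16].
have h1 : 0 < 1 - 2 * (eps + d) by lra.
have h2 : 0 < gamma + (eps + d) + d by lra.
have := H d d0 d16; rewrite -ler_expR expRD !lnK ?posrE// -/K => H'.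
lra.
Qed.

Theorem theorem2p1 (R : realType) (f : R[i] -> R[i]) (A : set R[i]) (eps : R)
  (Hf : H1 f) (Hnorm : H1norm f = 1%E)
  (HA : circle_measurable A) (Heps : eps < 1 / 4)
  (Hint : ((1 - eps)%:E <=
           (2 * pi)^-1%:E *
           \int[completed_lebesgue_measure]_(t in angles A)
             (complex.Re (boundary f (expi t)))%:E)%E) :
  exists2 gamma0 : R,
    0 < gamma0 < 1 /\
    (forall gamma : R, 0 < gamma < 1 ->
       measure_bound eps gamma <= measure_bound eps gamma0)
    & ((measure_bound eps gamma0)%:E <= circle_measure A)%E.
Proof.
have [fa _] := Hf; have [_ mA] := HA.
have p0 : 0 < 2 * pi :> R by rewrite mulr_gt0 ?pi_gt0.
have AI : angles A `<=` `[0, 2 * pi].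
  by move=> t [/andP[t0 tp] _]; rewrite /= in_itv/= t0 ltW.
have aA : ((2 * pi * (1 - eps))%:E <= \int[completed_lebesgue_measure]_(t in angles A)
             (complex.Re (boundary f (expi t)))%:E)%E.
  by rewrite mulrC EFinM -lee_pdivlMr// muleC.
set m := fine (completed_lebesgue_measure (angles A)) / (2 * pi).
have key gamma d : 0 < gamma < 1 -> 0 < d -> d <= 1 / 16 -> 0 <= eps + d /\
    ln (1 - 2 * (eps + d)) <= ln (gamma + (eps + d) + d) - m * ln gamma.
  move=> g01 d0 d16.
  have ca : 2 * pi * (1 - (eps + d)) < 2 * pi * (1 - eps).
    by rewrite ltr_pM2l//; lra.
  have [r r01 rP] := exists_radius fa mA AI ca aA.
  apply: (radial_bound fa r01 mA AI (H1norm_circle_le fa Hnorm r01) rP g01 d0).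
  lra.
(* For negative eps, a d of at most - eps / 2 would make eps + d negative, against [key]; the value
   1/2 of gamma is arbitrary. *)
have e0 : 0 <= eps.
  rewrite leNgt; apply/negP => eneg.
  have h2 : 0 < (1 / 2 : R) < 1 by apply/andP; split; lra.
  have d0 : 0 < Num.min (- eps / 2) (1 / 16) by rewrite lt_min; apply/andP; split; lra.
  have d16 : Num.min (- eps / 2) (1 / 16) <= 1 / 16 by rewrite ge_min lexx orbT.
  have [+ _] := key _ _ h2 d0 d16.
  have : Num.min (- eps / 2) (1 / 16) <= - eps / 2 by rewrite ge_min lexx.
  lra.
have [|g0 g01 gmax] := @measure_bound_max _ eps; first by rewrite e0.
exists g0 => //.
have bm : measure_bound eps g0 <= m.
  by apply: measure_bound_le => // d d0 d16; have [] := key _ _ g01 d0 d16.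
have muA : completed_lebesgue_measure (angles A) \is a fin_num.
  rewrite ge0_fin_numE ?measure_ge0//.
  apply: (@le_lt_trans _ _ (completed_lebesgue_measure (`[0, 2 * pi]%classic : set R))).
    apply: le_measure => //; rewrite inE //.
    by apply: borel_completed; exact: measurable_itv.
  rewrite [X in (X < _)%E](completed_lebesgueE `[0, 2 * pi]%classic).
  by rewrite lebesgue_measure_itv/= lte_fin p0 sube0 ltry.
by rewrite /circle_measure -(fineK muA) -EFinM lee_fin mulrC.
Qed.
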